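(* Let $q\ge 89$ be a prime power such that $3$ is not a square in $\mathbb{F}_q$. Then the track $$\{(1,t,t^2,t^3,t^4)\mid t\in \mathbb{F}_q\} \cup \{(0,1,2t,3t^2,4t^3) \mid t\in \mathbb{F}_q\} \cup \{(0,0,0,0,1)\}\subseteq \mathbb{P}^4(\mathbb{F}_q)$$ is complete.
   Context: Points of $\mathbb{P}^4(\mathbb{F}_q)$ are written in homogeneous coordinates $(x_0,x_1,x_2,x_3,x_4)$. A track in $\mathbb{P}^4(\mathbb{F}_q)$ is a set of points no four distinct of which lie on a common plane (a $2$-dimensional projective subspace). A track is complete if it is not a proper subset of a larger track in $\mathbb{P}^4(\mathbb{F}_q)$. (The given set is a track under the stated hypothesis on $3$.) *)

(* Defs.v *)
From HB Require Import structures.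
From mathcomp Require Import all_boot all_algebra.

Set Implicit Arguments.
Unset Strict Implicit.
Unset Printing Implicit Defensive.

Import GRing.Theory.
Local Open Scope ring_scope.

(* Over a finite field there are finitely many subspaces; this makes
   projective points a finType, so that {set _} is available for them. *)
Section FiniteSubspaces.
Import VectorInternalTheory.
HB.instance Definition _ (F : finFieldType) (vT : vectType F) :=
  [Countable of {vspace vT} by <:].
HB.instance Definition _ (F : finFieldType) (vT : vectType F) :=
  [Finite of {vspace vT} by <:].
End FiniteSubspaces.

Section ProjectiveSpace.
Variable F : finFieldType.

Definition P4 := {U : {vspace 'rV[F]_5} | \dim U == 1%N}.

Definition is_plane (W : {vspace 'rV[F]_5}) : bool := \dim W == 3%N.

Definition lies_on (P : P4) (W : {vspace 'rV[F]_5}) : bool := (val P <= W)%VS.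

(* No point has the zero vector as coordinates, since \dim <[0]> = 0. *)
Definition has_coords (P : P4) (x : 'rV[F]_5) : bool := val P == <[x]>%VS.

Definition track (S : {set P4}) : Prop :=
  forall A B C D : P4,
    A \in S -> B \in S -> C \in S -> D \in S ->
    uniq [:: A; B; C; D] ->
    ~ exists W : {vspace 'rV[F]_5},
        [/\ is_plane W, lies_on A W, lies_on B W, lies_on C W
          & lies_on D W].

Definition complete_track (S : {set P4}) : Prop :=
  track S /\ ~ exists T : {set P4}, track T /\ S \proper T.

Definition coords (a b c d e : F) : 'rV[F]_5 :=
  \row_(i < 5) [:: a; b; c; d; e]`_i.

Definition curve_points : {set P4} :=
  [set P | [exists t : F, has_coords P (coords 1 t (t ^+ 2) (t ^+ 3) (t ^+ 4))]].

Definition tangent_points : {set P4} :=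
  [set P | [exists t : F,
    has_coords P (coords 0 1 (2 * t) (3 * t ^+ 2) (4 * t ^+ 3))]].

Definition infinity_point : {set P4} :=
  [set P | has_coords P (coords 0 0 0 0 1)].

End ProjectiveSpace.

(* Main.v *)
(* A point (x_0 : ... : x_4) is a functional phi on quartics, phi (T^n) = x_n. The
   points of the track are the evaluations f (t), the derivatives f' (t) and the
   leading coefficient, and the theorem says that any four of these are independent
   (by interpolation; this is where 3 has to be a nonsquare), and that every phi
   is a combination of three of them.
   For s in F, phi is a combination of f (s) and two further evaluations as soon as
   the discriminant D1 (s) of the quadratic form apolar to f |-> phi ((T - s) f) is a
   nonzero square. Likewise, phi is a combination of f (a) and two derivatives as
   soon as a discriminant D2 (a) is a nonzero square. Here deg D1 <= 4 and
   deg D2 <= 10. A polynomial of degree at most 10 without nonzero square values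
   is a constant times a square: by an argument in the style of Stepanov, if D is
   a nonsquare at every point then D^((q-1)/2), cut into five digits in base T^q, is
   a Pade-like approximation of D^(-1/2) of such a quality that the 6th and 7th Taylor
   coefficients of the square root of D vanish, so that D has no simple factor.
   So only those phi remain for which D1 is a constant times a square. Up to
   translation these lie on a secant or tangent line of the quartic curve, or are
   (0 : 0 : 1 : 0 : 0) or (3 : 0 : -d : 0 : 3 d^2); the ones not covered by
   explicit combinations are treated with D2. *)

Require Import Defs.
From mathcomp Require Import all_boot all_algebra.
From mathcomp Require Import all_field ring zify.

Import GRing.Theory.
Local Open Scope ring_scope.

Set Implicit Arguments.
Unset Strict Implicit.
Unset Printing Implicit Defensive.

(** * Power series modulo X^8 *)

Section TruncatedSeries.
Variable R : comNzRingType.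
Implicit Types f g h : {poly R}.

(** Eight coefficients are kept because the argument reads off those of degree 6 and 7. *)
Definition eqX8 f g := exists h, f = g + 'X^8 * h.

Lemma eqX8_refl f : eqX8 f f.
Proof. by exists 0; rewrite mulr0 addr0. Qed.

Lemma eqX8_sym f g : eqX8 f g -> eqX8 g f.
Proof. by case=> h ->; exists (- h); ring. Qed.

Lemma eqX8_trans f g h : eqX8 f g -> eqX8 g h -> eqX8 f h.
Proof. by case=> a -> [b ->]; exists (a + b); ring. Qed.

Lemma eqX8D f g f' g' : eqX8 f g -> eqX8 f' g' -> eqX8 (f + f') (g + g').
Proof. by case=> a -> [b ->]; exists (a + b); ring. Qed.

Lemma eqX8B f g f' g' : eqX8 f g -> eqX8 f' g' -> eqX8 (f - f') (g - g').
Proof. by case=> a -> [b ->]; exists (a - b); ring. Qed.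

Lemma eqX8M f g f' g' : eqX8 f g -> eqX8 f' g' -> eqX8 (f * f') (g * g').
Proof.
by case=> a -> [b ->]; exists (g * b + a * g' + 'X^8 * a * b); ring.
Qed.

Lemma eqX8Ml f g h : eqX8 f g -> eqX8 (h * f) (h * g).
Proof. by apply: eqX8M; apply: eqX8_refl. Qed.

Lemma eqX8Mr f g h : eqX8 f g -> eqX8 (f * h) (g * h).
Proof. by move=> fg; apply: eqX8M => //; apply: eqX8_refl. Qed.

Lemma eqX8_sum (I : Type) (r : seq I) (P : pred I) (f g : I -> {poly R}) :
  (forall i, P i -> eqX8 (f i) (g i)) ->
  eqX8 (\sum_(i <- r | P i) f i) (\sum_(i <- r | P i) g i).
Proof.
move=> fg; elim/big_rec2: _ => [|i y x Pi yx]; first exact: eqX8_refl.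
by apply: eqX8D => //; apply: fg.
Qed.

Lemma eqX8_exp f g n : eqX8 f g -> eqX8 (f ^+ n) (g ^+ n).
Proof.
move=> fg; elim: n => [|n IHn]; first by rewrite !expr0; apply: eqX8_refl.
by rewrite !exprS; apply: eqX8M.
Qed.

Lemma eqX8_coef f g k : eqX8 f g -> (k < 8)%N -> f`_k = g`_k.
Proof. by case=> h -> lk8; rewrite coefD coefXnM lk8 addr0. Qed.

Lemma coef_scale f (c : R) k : (f \Po (c%:P * 'X))`_k = c ^+ k * f`_k.
Proof.
elim/poly_ind: f k => [|f a IHf] k; first by rewrite comp_poly0 !coef0 mulr0.
rewrite comp_poly_MXaddC mulrA coefD coefMX coefMC IHf coefC coefD coefMX coefC.
by case: k => [|k] /=; rewrite ?exprS; ring.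
Qed.

(* A square root of 1 with constant term 1: from [(f - 1) * (f + 1) = 0] one
   gets [f - 1 = - h * (f - 1) ^ 2], so its order doubles until it exceeds 8. *)
Lemma eqX8_sqrt1 (h : R) g :
  2 * h = 1 -> eqX8 ((1 + 'X * g) ^+ 2) 1 -> eqX8 (1 + 'X * g) 1.
Proof.
move=> hK [k kE].
have hKP : 2 * h%:P = 1 :> {poly R}.
  by transitivity ((2 * h)%:P); [rewrite rmorphM rmorph_nat | rewrite hK].
set a := 'X * g.
have aE : eqX8 a (- h%:P * a ^+ 2).
  exists (h%:P * k); move: kE; rewrite -/a => kE.
  have -> : 'X^8 * (h%:P * k) = h%:P * ((1 + a) ^+ 2 - 1) by rewrite kE; ring.
  by transitivity (2 * h%:P * a); [rewrite hKP mul1r | ring].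
have dbl n b : eqX8 a ('X^n * b) -> exists c, eqX8 a ('X^(n + n) * c).
  move=> ab; exists (- h%:P * b ^+ 2); apply: eqX8_trans aE _.
  have -> : 'X^(n + n) * (- h%:P * b ^+ 2) = - h%:P * ('X^n * b) ^+ 2.
    by rewrite exprD; ring.
  by apply: eqX8Ml; apply: eqX8_exp.
(* The order of [a] goes from 1 to 2, 4 and 8. *)
have [c1 /dbl[c2 /dbl[c3 h8]]] := dbl 1%N g (eqX8_refl a).
rewrite -[X in eqX8 _ X]addr0; apply: eqX8D; first exact: eqX8_refl.
by apply: eqX8_trans h8 _; exists c3; rewrite add0r.
Qed.

End TruncatedSeries.

(** * Degree bounds for the coefficients of power series *)

Section Weights.
Variable F : fieldType.
Implicit Types (f g : {poly {poly F}}) (A : {poly F}).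

(* In the application, the variable of {poly {poly F}} is an infinitesimal
   shifting 'X by a multiple of a polynomial H of degree at most 10; each power
   of it therefore costs 9 in degree. *)
Definition weight c f := forall k, (k < 8)%N -> (size (f`_k)%R <= (c + 9 * k).+1)%N.

Lemma weight_le c d f : (c <= d)%N -> weight c f -> weight d f.
Proof. by move=> le_cd wf k /wf; lia. Qed.

Lemma weight_eqX8 c f g : eqX8 f g -> weight c f -> weight c g.
Proof. by move=> fg wf k lk8; rewrite -(eqX8_coef fg) ?wf. Qed.

Lemma weightD c f g : weight c f -> weight c g -> weight c (f + g).
Proof.
move=> wf wg k lk8; rewrite coefD (leq_trans (size_polyD _ _)) //.
by rewrite geq_max wf ?wg.
Qed.

Lemma weightN c f : weight c f -> weight c (- f).
Proof. by move=> wf k lk8; rewrite coefN size_polyN wf. Qed.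

Lemma weightM c d f g : weight c f -> weight d g -> weight (c + d) (f * g).
Proof.
move=> wf wg k lk8; rewrite coefM (leq_trans (size_sum _ _ _)) //.
apply/bigmax_leqP => i _; rewrite (leq_trans (size_polyMleq _ _)) //.
have /wf := leq_ltn_trans (leq_ord i) lk8.
have /wg := leq_ltn_trans (leq_subr i k) lk8.
by have := leq_ord i; lia.
Qed.

Lemma weight_sum c (I : Type) (r : seq I) (P : pred I) (f : I -> {poly {poly F}}) :
  (forall i, P i -> weight c (f i)) -> weight c (\sum_(i <- r | P i) f i).
Proof.
move=> wf; elim/big_rec: _ => [|i y Pi wy]; last by apply: weightD; first exact: wf.
by move=> k _; rewrite coef0 size_poly0.
Qed.

Lemma weightC c A : (size A <= c.+1)%N -> weight c A%:P.
Proof. by move=> sA [|k] _; rewrite coefC //= ?size_poly0 // addn0. Qed.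

Lemma weightXn c f n : weight c f -> weight (n * c) (f ^+ n).
Proof.
move=> wf; elim: n => [|n IHn]; last by rewrite exprS mulSn; apply: weightM.
by rewrite expr0; apply: weightC; rewrite size_poly1.
Qed.

(** Over a field degrees add, so dividing by a factor free of the series variable lowers the bound
    by its degree. *)
Lemma weight_cancel c A f : A != 0 ->
  weight ((size A).-1 + c) (A%:P * f) -> weight c f.
Proof.
move=> nzA wAf k lk8; move/(_ k lk8): wAf; rewrite coefCM.
have [->|nzf] := eqVneq f`_k 0; first by rewrite size_poly0.
rewrite size_mul //; move: nzA nzf; rewrite -!size_poly_gt0.
by move: (size A) (size (f`_k)%R) => a b; lia.
Qed.

End Weights.

(** * Taylor expansion at an infinitesimally shifted point *)

Section Shift.
Variables (F : fieldType) (H : {poly F}).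
Implicit Types A B : {poly F}.

(** The point T + H eps, where T is the inner variable and eps the outer one. *)
Definition shift_pt : {poly {poly F}} := 'X%:P + H%:P * 'X.

Definition shift A := A^:P \Po shift_pt.

Lemma shiftD A B : shift (A + B) = shift A + shift B.
Proof. by rewrite /shift !rmorphD. Qed.

Lemma shiftB A B : shift (A - B) = shift A - shift B.
Proof. by rewrite /shift !rmorphB. Qed.

Lemma shiftM A B : shift (A * B) = shift A * shift B.
Proof. by rewrite /shift !rmorphM. Qed.

Lemma shift1 : shift 1 = 1.
Proof. by rewrite /shift !rmorph1. Qed.

Lemma shift_exp A n : shift (A ^+ n) = shift A ^+ n.
Proof. by rewrite /shift !rmorphXn. Qed.

Lemma shift_sum I (r : seq I) P (A : I -> {poly F}) :
  shift (\sum_(i <- r | P i) A i) = \sum_(i <- r | P i) shift (A i).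
Proof. by rewrite /shift !rmorph_sum. Qed.

Lemma shiftX : shift 'X = shift_pt.
Proof. by rewrite /shift map_polyX comp_polyX. Qed.

Lemma shiftMXaddC A c :
  shift (A * 'X + c%:P) = shift A * shift_pt + (c%:P)%:P.
Proof.
by rewrite shiftD shiftM shiftX {2}/shift map_polyC comp_polyC.
Qed.

Lemma shift_taylor2 A : exists Q, shift A =
  A%:P + 'X * H%:P * (A^`())%:P + 'X ^+ 2 * H%:P ^+ 2 * Q.
Proof.
elim/poly_ind: A => [|A c [Q IHA]].
  by exists 0; rewrite deriv0 /shift !rmorph0; ring.
rewrite shiftMXaddC IHA derivMXaddC.
exists (Q * shift_pt + (A^`())%:P); rewrite !rmorphD !rmorphM /shift_pt /=; ring.
Qed.

Lemma shift_taylor1 A : exists Q, shift A = A%:P + 'X * H%:P * Q.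
Proof.
have [Q ->] := shift_taylor2 A.
by exists ((A^`())%:P + 'X * H%:P * Q); ring.
Qed.

Hypothesis sH : (size H <= 11)%N.

(** The coefficient [H] of eps has degree at most 10 = 1 + 9, which is just what weight 1 allows
    there. *)
Lemma weight_shift_pt : weight 1 shift_pt.
Proof.
apply: weightD; first by apply: weightC; rewrite size_polyX.
move=> [|[|k]] lk8; rewrite coefMX coefC ?size_poly0 //=; exact: leq_trans sH _.
Qed.

Lemma weight_shift A c : (size A <= c.+1)%N -> weight c (shift A).
Proof.
move=> sA; rewrite /shift comp_polyE; apply: weight_sum => i _.
rewrite -mul_polyC coef_map /= -[c]add0n; apply: weightM.
  by apply: weightC; rewrite size_polyC leq_b1.
apply: (@weight_le _ (i * 1)); last by apply: weightXn; apply: weight_shift_pt.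
by have := ltn_ord i; rewrite [X in (_ < X)%N]size_map_polyC muln1 => li; lia.
Qed.

End Shift.

(** * Truncated square roots, digits and Frobenius *)

Section SqrtSeries.
Variable R : comNzRingType.
Implicit Types w : R.

(* Truncation of the power series of sqrt (1 + 4 * w), whose coefficients are,
   up to sign, twice the Catalan numbers. *)
Definition sqrt14 w : R :=
  1 + 2 * w - 2 * w ^+ 2 + 4 * w ^+ 3 - 10 * w ^+ 4 + 28 * w ^+ 5
    - 84 * w ^+ 6 + 264 * w ^+ 7.

Lemma sqrt14_sqr w : exists e, sqrt14 w ^+ 2 = 1 + 4 * w + w ^+ 8 * e.
Proof.
(* These are the coefficients of degree 8 to 14 of the square. *)
exists (4 * 429 - 16 * 143 * w + 32 * 143 * w ^+ 2 - 64 * 156 * w ^+ 3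
  + 16 * 15 * 91 * w ^+ 4 - 64 * 9 * 77 * w ^+ 5 + 264 ^+ 2 * w ^+ 6); rewrite /sqrt14; ring.
Qed.

Lemma inv1_trunc w :
  (1 + w) * (1 - w + w ^+ 2 - w ^+ 3 + w ^+ 4 - w ^+ 5 + w ^+ 6 - w ^+ 7)
    = 1 - w ^+ 8.
Proof. ring. Qed.

Lemma sqrt14_0 : sqrt14 0 = 1.
Proof. rewrite /sqrt14; ring. Qed.

Lemma sqrt14D w e : exists e', sqrt14 (w + e) = sqrt14 w + e * e'.
Proof.
exists (2 - 2 * (2 * w + e) + 4 * (3 * w ^+ 2 + 3 * w * e + e ^+ 2)
 - 10 * (4 * w ^+ 3 + 6 * w ^+ 2 * e + 4 * w * e ^+ 2 + e ^+ 3)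
 + 28 * (5 * w ^+ 4 + 10 * w ^+ 3 * e + 10 * w ^+ 2 * e ^+ 2 + 5 * w * e ^+ 3
   + e ^+ 4)
 - 84 * (6 * w ^+ 5 + 15 * w ^+ 4 * e + 20 * w ^+ 3 * e ^+ 2
   + 15 * w ^+ 2 * e ^+ 3 + 6 * w * e ^+ 4 + e ^+ 5)
 + 264 * (7 * w ^+ 6 + 21 * w ^+ 5 * e + 35 * w ^+ 4 * e ^+ 2
   + 35 * w ^+ 3 * e ^+ 3 + 21 * w ^+ 2 * e ^+ 4 + 7 * w * e ^+ 5 + e ^+ 6)).
rewrite /sqrt14; ring.
Qed.

End SqrtSeries.

Section SqrtPower.
Variable R : comNzRingType.

(** With [f = 1 + 'X * v] and [h] = 1/2, the second factor is a square root of [f] modulo X^8, so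
    the product has the square [f ^+ m.*2.+1]. Its constant term is 1, and [eqX8_sqrt1] applies. *)
Lemma sqrt14_exp (h : R) (v : {poly R}) m :
  2 * h = 1 -> eqX8 ((1 + 'X * v) ^+ m.*2.+1) 1 ->
  eqX8 ((1 + 'X * v) ^+ m * sqrt14 ((h ^+ 2)%:P * ('X * v))) 1.
Proof.
move=> hK fq; set w := _%:P * _; set f := 1 + 'X * v in fq *.
have [g gE] : exists g, f ^+ m * sqrt14 w = 1 + 'X * g.
  have [a aE] : exists a, f ^+ m = 1 + 'X * a.
    elim: m {fq} => [|k [a IHa]]; first by exists 0; rewrite mulr0 addr0.
    by exists (a + v + 'X * v * a); rewrite exprS IHa /f; ring.
  have [b bE] := sqrt14D 0 w; rewrite add0r in bE.
  exists (a + (1 + 'X * a) * (h ^+ 2)%:P * v * b).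
  by rewrite aE bE sqrt14_0 /w; ring.
rewrite gE; apply: (eqX8_sqrt1 hK); rewrite -gE.
have hKP : 4 * (h ^+ 2)%:P = 1 :> {poly R}.
  transitivity (((2 * h) ^+ 2)%:P); last by rewrite hK expr1n.
  by rewrite !rmorphXn /= rmorphM rmorph_nat; ring.
have [e eE] := sqrt14_sqr w.
have wE : 4 * w = 'X * v by rewrite /w mulrA hKP mul1r.
apply: eqX8_trans fq; rewrite exprMn eE wE -/f.
exists ((f ^+ m) ^+ 2 * ((h ^+ 2)%:P * v) ^+ 8 * e).
have -> : f ^+ m.*2.+1 = (f ^+ m) ^+ 2 * f by rewrite -exprM muln2 exprSr.
have -> : w ^+ 8 = 'X^8 * ((h ^+ 2)%:P * v) ^+ 8.
  by rewrite /w mulrCA exprMn.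
have key (a b c d : {poly R}) : c * (d + a * b * e) = c * d + a * (c * b * e).
  by rewrite mulrDr -!mulrA [c * (a * _)]mulrCA.
exact: (key 'X^8 (((h ^+ 2)%:P * v) ^+ 8) (f ^+ m ^+ 2) f).
Qed.

End SqrtPower.

Section Digits.
Variable R : nzRingType.

Lemma poly_digits q n (y : {poly R}) : (size y <= q * n)%N ->
  exists2 A : nat -> {poly R}, (forall j, (size (A j) <= q)%N) &
    y = \sum_(j < n) 'X^(q * j) * A j.
Proof.
elim: n y => [|n IHn] y sy.
  exists (fun=> 0) => [j|]; first by rewrite size_poly0.
  by rewrite big_ord0; apply/eqP; rewrite -size_poly_leq0 -(muln0 q).
have [|A sA yE] := IHn (drop_poly q y); first by rewrite size_drop_poly; lia.
exists (fun j => if j is j'.+1 then A j' else take_poly q y) => [[|j]|] //.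
  exact: size_take_poly.
rewrite big_ord_recl /= muln0 expr0 mul1r -{1}(poly_take_drop q y); congr (_ + _).
rewrite {1}yE mulr_suml; apply: eq_bigr => i _.
rewrite /bump /= add1n mulnS exprD -[RHS]mulrA; exact: commr_polyXn.
Qed.

End Digits.

Lemma rmorph_sqrt14 (R S : comNzRingType) (f : {rmorphism R -> S}) (w : R) :
  f (sqrt14 w) = sqrt14 (f w).
Proof.
by rewrite /sqrt14 !(rmorphD, rmorphN, rmorphM, rmorphXn, rmorph_nat, rmorph1).
Qed.

Lemma weight_nat (F : fieldType) n : weight 0 (n%:R : {poly {poly F}}).
Proof.
by rewrite -polyC_natr; apply: weightC; rewrite -polyC_natr size_polyC leq_b1.
Qed.

Lemma weight0M (F : fieldType) (f g : {poly {poly F}}) :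
  weight 0 f -> weight 0 g -> weight 0 (f * g).
Proof. exact: weightM. Qed.

Lemma weight0X (F : fieldType) (f : {poly {poly F}}) n :
  weight 0 f -> weight 0 (f ^+ n).
Proof. by move=> /(@weightXn _ _ _ n); rewrite muln0. Qed.

Lemma weight_sqrt14 (F : fieldType) (w : {poly {poly F}}) :
  weight 0 w -> weight 0 (sqrt14 w).
Proof.
move=> ww; have wt n k : weight 0 (n%:R * w ^+ k).
  by apply: weight0M; [apply: weight_nat | apply: weight0X].
rewrite /sqrt14; do ![apply: weightD | apply: weightN]; try exact: wt.
  exact: (weight_nat _ 1).
exact: (wt 2%N 1%N).
Qed.

Section Frobenius.
Variable F : finFieldType.
Hypothesis q_ge : (8 <= #|F|)%N.

Lemma polypoly_pnat : [pchar {poly {poly F}}].-nat #|F|.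
Proof.
have [p p_pr pF] := finPcharP F.
have pFF : p \in [pchar {poly {poly F}}] by rewrite !pchar_poly.
by rewrite (card_pprimeChar pF) pnatX (pnatE _ p_pr) pFF.
Qed.

(** The q-th power is additive and moves the linear term to degree q, beyond the truncation. *)
Lemma frobeniusX8 (f g : {poly {poly F}}) :
  eqX8 ((f + g * 'X) ^+ #|F|) (f ^+ #|F|).
Proof.
rewrite (exprDn_pchar _ _ polypoly_pnat).
exists (g ^+ #|F| * 'X^(#|F| - 8)); rewrite exprMn.
by rewrite mulrCA -exprD subnKC.
Qed.

End Frobenius.
Lemma coef_sqrt14 (R : comNzRingType) (c : R) :
  (sqrt14 (c%:P * 'X))`_6 = - (84 * c ^+ 6) /\
  (sqrt14 (c%:P * 'X))`_7 = 264 * c ^+ 7.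
Proof.
have coef7 (a1 a2 a3 a4 a5 a6 a7 : R) :
    let f := 1 + a1%:P * 'X + a2%:P * 'X^2 + a3%:P * 'X^3 + a4%:P * 'X^4
      + a5%:P * 'X^5 + a6%:P * 'X^6 + a7%:P * 'X^7 in f`_6 = a6 /\ f`_7 = a7.
  move=> f; rewrite /f !(coefD, coefCM, coefXn, coefX, coef1) /=.
  by rewrite !(mulr0, mulr1, addr0, add0r).
have natC k n : k%:R * (c%:P * 'X) ^+ n = (k%:R * c ^+ n)%:P * 'X^n :> {poly R}.
  by rewrite rmorphM rmorph_nat rmorphXn exprMn mulrA.
have natN k n : - (k%:R * (c%:P * 'X) ^+ n) = (- (k%:R * c ^+ n))%:P * 'X^n :> {poly R}.
  by rewrite rmorphN mulNr natC.
have -> : sqrt14 (c%:P * 'X) = 1 + (2 * c)%:P * 'X + (- (2 * c ^+ 2))%:P * 'X^2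
  + (4 * c ^+ 3)%:P * 'X^3 + (- (10 * c ^+ 4))%:P * 'X^4 + (28 * c ^+ 5)%:P * 'X^5
  + (- (84 * c ^+ 6))%:P * 'X^6 + (264 * c ^+ 7)%:P * 'X^7.
  rewrite /sqrt14 -!natN -!natC; do 6!congr (_ + _).
  by congr (_ + _); exact: (natC 2 1%N).
exact: coef7.
Qed.

Lemma size_coef_eq0 (R : nzRingType) (f : {poly R}) n k :
  (size f <= n)%N -> (n <= k)%N -> f`_k = 0.
Proof. by move=> sf nk; apply: nth_default; apply: leq_trans nk. Qed.

(** * Polynomials without nonzero square values *)

Section FrobeniusMinusX.
Variable F : finFieldType.

Definition XqX : {poly F} := 'X^#|F| - 'X.

Lemma size_XqX : size XqX = #|F|.+1.
Proof.
have q_gt1 := finNzRing_gt1 F.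
by rewrite size_polyDl size_polyXn // size_polyN size_polyX ltnS.
Qed.

Lemma XqX_neq0 : XqX != 0.
Proof. by rewrite -size_poly_gt0 size_XqX. Qed.

Lemma XqX_dvd (f : {poly F}) : (forall s, f.[s] = 0) -> XqX %| f.
Proof.
move=> f0; rewrite /XqX finField_genPoly -big_enum /=; apply: uniq_roots_dvdp.
  by apply/allP => s _; rewrite rootE f0.
by rewrite uniq_rootsE enum_uniq.
Qed.

(** This is how the size of q is exploited: below degree q there is no room for a nonzero multiple
    of T^q - T. *)
Lemma size_eq0_of_XqX (f g : {poly F}) :
  (size f <= #|F|)%N -> XqX * g = f -> g = 0.
Proof.
move=> sf fE; apply/eqP; apply: contraLR sf => nzg.
rewrite -fE size_mul ?XqX_neq0 // size_XqX -ltnNge addSn /=.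
by rewrite -[X in (X < _)%N]addn0 ltn_add2l size_poly_gt0.
Qed.

End FrobeniusMinusX.

Lemma shift_scale (F : fieldType) (D G A : {poly F}) :
  shift (D * G) A = shift D A \Po (G%:P * 'X).
Proof.
rewrite /shift -comp_polyA; congr (_ \Po _).
by rewrite /shift_pt comp_polyD comp_polyM !comp_polyC comp_polyX rmorphM /= mulrA.
Qed.

(** * Vanishing Taylor coefficients by Stepanov's method *)

Section Core.
Variables (F : finFieldType) (D G : {poly F}) (m : nat).
Hypothesis q_ge : (89 <= #|F|)%N.
Hypothesis q_odd : #|F| = m.*2.+1.
Hypothesis two_neq0 : (2 : F) != 0.
Hypothesis nzG : G != 0.
Hypothesis sD : (1 < size D)%N.
Hypothesis sH : (size (D * G)%R <= 11)%N.
Hypothesis valD : forall s, (D * G).[s] = 0 \/ D.[s] ^+ m = -1.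

Local Notation q := #|F|.
Local Notation H := (D * G).
Local Notation pt := (shift_pt H).
Local Notation Pi := (XqX F).
Local Notation t := ('X^q)%:P.

Let nzD : D != 0.
Proof. by rewrite -size_poly_gt0 ltnW. Qed.

Let sDG : (size D <= 11)%N.
Proof.
apply: leq_trans sH; rewrite size_mul // -subn1 -addnBA ?leq_addr //.
by rewrite size_poly_gt0.
Qed.

Let nzH : H != 0. Proof. by rewrite mulf_neq0. Qed.

Lemma shift_Xq_pow j : eqX8 (shift H ('X^(q * j))) (('X^(q * j))%:P).
Proof.
rewrite !exprM rmorphXn shift_exp; apply: eqX8_exp.
rewrite shift_exp shiftX /shift_pt rmorphXn.
by apply: frobeniusX8; apply: leq_trans q_ge.
Qed.

(* The A j are the digits of D ^+ m in base T^q, so that the sum of the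
   T^j * A j is D ^+ m reduced modulo T^q - T: it is -1 off the zeros of H. *)
Lemma digits_quotient (A : nat -> {poly F}) :
  (forall j, (size (A j) <= q)%N) ->
  D ^+ m = \sum_(j < 5) 'X^(q * j) * A j ->
  exists2 E : {poly F}, (size E <= 14)%N & H * (\sum_(j < 5) 'X^j * A j + 1) = Pi * E.
Proof.
move=> sA DmE; set Z := \sum_(j < 5) _.
have PiZ : Pi %| H * (Z + 1).
  apply: XqX_dvd => s; rewrite hornerM.
  have [-> | Ds] := valD s; first by rewrite mul0r.
  rewrite hornerD hornerC [X in X + 1](_ : _ = -1) ?addNr ?mulr0 //.
  rewrite -Ds -horner_exp DmE !horner_sum; apply: eq_bigr => j _.
  by rewrite !hornerM !hornerXn exprM expf_card.
exists ((H * (Z + 1)) %/ Pi); last by rewrite [RHS]mulrC divpK.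
rewrite size_divp ?XqX_neq0 // size_XqX.
(* Digits have degree below q and are multiplied by at most T^4, so the quotient has degree at most
   10 + (q + 3) - q = 13. *)
have sZ : (size (Z + 1)%R <= q + 4)%N.
  rewrite (leq_trans (size_polyD _ _)) // geq_max size_poly1; apply/andP; split; last by lia.
  rewrite (leq_trans (size_sum _ _ _)) //; apply/bigmax_leqP => j _.
  rewrite (leq_trans (size_polyMleq _ _)) // size_polyXn.
  by have := sA j; have := ltn_ord j; lia.
rewrite leq_subLR (leq_trans (size_polyMleq _ _)) //.
apply: (@leq_trans (11 + (q + 4)).-1); last by lia.
by rewrite -!subn1 leq_sub2r // leq_add.
Qed.

(** Shifting by a multiple of [D] avoids denominators: D (T + D eps) = D (1 + eps v), and replacing
    eps by G eps gives the shift by [H]. Here [s] is the square root of 1 + eps v; as q = 2m + 1 and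
    the q-th power of 1 + eps v is 1 modulo eps^8, the m-th power is inverse to [s]. *)
Lemma sqrt_series : exists (s v : {poly {poly F}}),
  [/\ s = sqrt14 (((2^-1)%:P ^+ 2)%:P * ('X * v)),
      exists Q, v = (D^`())%:P + D%:P * ('X * Q),
      weight 0 (s \Po (G%:P * 'X)) &
      eqX8 (shift H (D ^+ m) * (s \Po (G%:P * 'X))) (D ^+ m)%:P].
Proof.
have [Q DE] := shift_taylor2 D D.
set v := (D^`())%:P + D%:P * ('X * Q).
exists (sqrt14 (((2^-1)%:P ^+ 2)%:P * ('X * v))), v.
have hK : 2 * (2^-1)%:P = 1 :> {poly F}.
  by rewrite -(polyC_natr _ 2) -polyCM mulfV.
set v' := G%:P * (v \Po (G%:P * 'X)).
have sE : sqrt14 (((2^-1)%:P ^+ 2)%:P * ('X * v)) \Po (G%:P * 'X)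
    = sqrt14 (((2^-1)%:P ^+ 2)%:P * ('X * v')).
  rewrite rmorph_sqrt14 /= !comp_polyM comp_polyC comp_polyX; congr (sqrt14 (_ * _)).
  by rewrite /v' mulrCA mulrA.
have DHE : shift H D = D%:P * (1 + 'X * v').
  rewrite shift_scale DE.
  have -> : D%:P + 'X * D%:P * (D^`())%:P + 'X^2 * D%:P ^+ 2 * Q
      = D%:P * (1 + 'X * v) by rewrite /v; ring.
  rewrite comp_polyM comp_polyC comp_polyD comp_polyM comp_polyX rmorph1.
  by rewrite /v'; congr (_ * (_ + _)); rewrite mulrCA mulrA.
have wv' : weight 0 ('X * v').
  have w1 : weight 0 (1 + 'X * v').
    apply: (weight_cancel nzD); rewrite addn0 -DHE; apply: weight_shift => //.
    by rewrite prednK // size_poly_gt0.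
  have -> : 'X * v' = (1 + 'X * v') - 1 by ring.
  by apply: weightD => //; apply: weightN; apply: (weight_nat _ 1).
split=> //; first by exists Q.
- rewrite sE; apply: weight_sqrt14; apply: weight0M => //.
  by apply: weightC; rewrite -rmorphXn /= size_polyC leq_b1.
- rewrite sE shift_exp DHE exprMn -mulrA -[X in eqX8 _ X]mulr1 [(D ^+ m)%:P]rmorphXn /=.
  apply: eqX8Ml; apply: sqrt14_exp => //.
  rewrite -q_odd mulrC -[X in eqX8 _ X](expr1n _ q).
  by apply: frobeniusX8; apply: leq_trans q_ge.
Qed.

(* In the application, s is the square root of shift H D / D. Expressing the sum
   a of the (T + H eps)^j * A j, which has degree 4 in eps, through s gives, with
   Gam small,
     H * a = - H * s + (T^q - T - H * eps) * Gam  modulo eps^8.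
   In degrees 5, 6 and 7 the left-hand side vanishes, and q is so large that the
   multiples of T^q - T have to vanish separately. *)
Lemma sqrt_series_coef0 (s : {poly {poly F}}) :
  weight 0 s -> eqX8 (shift H (D ^+ m) * s) (D ^+ m)%:P -> s`_6 = 0 /\ s`_7 = 0.
Proof.
move=> ws Ds.
(* The degree is at most 10 m < 5 q, hence five digits. *)
have sDm : (size (D ^+ m)%R <= q * 5)%N.
  apply: leq_trans (size_poly_exp_leq _ _) _.
  have : ((size D).-1 * m <= 10 * m)%N by rewrite leq_mul2r; move: sDG; lia.
  by rewrite q_odd; lia.
have [A sA DmE] := poly_digits sDm.
have [E sE ZE] := digits_quotient sA DmE.
(* The shift fixes T^q modulo eps^8, so by [Ds] the sum of the T^(q j) C_j vanishes modulo eps^8. *)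
pose C j : {poly {poly F}} := shift H (A j) * s - (A j)%:P.
have wC j : weight q.-1 (C j).
  have sAj : (size (A j) <= q.-1.+1)%N by rewrite prednK // (leq_trans _ q_ge).
  apply: weightD; last by apply: weightN; apply: weightC.
  by rewrite -[q.-1]addn0; apply: weightM => //; apply: weight_shift.
have C0 : eqX8 (\sum_(j < 5) ('X^(q * j))%:P * C j) 0.
  have -> : \sum_(j < 5) ('X^(q * j))%:P * C j =
      (\sum_(j < 5) ('X^(q * j))%:P * shift H (A j)) * s - (D ^+ m)%:P.
    rewrite DmE rmorph_sum mulr_suml -sumrB; apply: eq_bigr => j _.
    by rewrite /C mulrBr mulrA rmorphM.
  rewrite -[X in eqX8 _ X](subrr (D ^+ m)%:P); apply: eqX8B; last exact: eqX8_refl.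
  apply: eqX8_trans Ds; apply: eqX8Mr; rewrite DmE shift_sum.
  apply: eqX8_sum => j _; rewrite shiftM; apply: eqX8Mr.
  by apply: eqX8_sym; apply: shift_Xq_pow.
have tE j : ('X^(q * j))%:P = t ^+ j :> {poly {poly F}} by rewrite exprM rmorphXn.
move: C0; rewrite !big_ord_recr big_ord0 /= !tE !add0r expr0 expr1 mul1r => C0.
(* Up to sign, these are the coefficients of the quotient in the Horner division of the polynomial
   with coefficients [C j] by its approximate root T^q. *)
pose R3 : {poly {poly F}} := - C 4; pose R2 : {poly {poly F}} := - (C 3 + t * C 4).
pose R1 : {poly {poly F}} := - (C 2 + t * C 3 + t ^+ 2 * C 4).
pose R0 : {poly {poly F}} := - (C 1%N + t * C 2 + t ^+ 2 * C 3 + t ^+ 3 * C 4).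
have tR0 : eqX8 (t * R0) (C 0%N).
  have -> : t * R0 = C 0%N - (C 0%N - t * R0) by ring.
  rewrite -[X in eqX8 _ X]subr0; apply: eqX8B; first exact: eqX8_refl.
  by move: C0; congr eqX8; rewrite /R0; ring.
(* Modulo eps^8, T^q R0 = C_0, T^q R1 = C_1 + R0 and so on. The right-hand sides have weight q, so
   each quotient has weight 0, despite the high powers of T in its definition. *)
have wcancel (r f : {poly {poly F}}) : weight q f -> eqX8 (t * r) f -> weight 0 r.
  move=> wf rf; apply: (@weight_cancel _ _ ('X^q)); first by rewrite -size_poly_gt0 size_polyXn.
  by rewrite size_polyXn addn0; apply: weight_eqX8 wf; apply: eqX8_sym.
have wCq j : weight q (C j) by apply: weight_le (wC j); apply: leq_pred.
have wR0 : weight 0 R0 by apply: wcancel tR0.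
have wnext i (r r' : {poly {poly F}}) : weight 0 r -> t * r' = C i + r -> weight 0 r'.
  move=> wr r'E; have wCr : weight q (C i + r).
    by apply: weightD; [exact: wCq | exact: weight_le wr].
  refine (wcancel r' _ wCr _); rewrite r'E; apply: eqX8_refl.
have wR1 : weight 0 R1 by apply: (wnext 1%N _ _ wR0); rewrite /R1 /R0; ring.
have wR2 : weight 0 R2 by apply: (wnext 2 _ _ wR1); rewrite /R2 /R1; ring.
have wR3 : weight 0 R3 by apply: (wnext 3 _ _ wR2); rewrite /R3 /R2; ring.
pose rho : {poly {poly F}} := R0 + pt * R1 + pt ^+ 2 * R2 + pt ^+ 3 * R3.
have wrho : weight 3 rho.
  have wpt k : weight k (pt ^+ k).
    by rewrite -[X in weight X _]muln1; apply: weightXn; apply: weight_shift_pt.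
  have wptM k r : (k <= 3)%N -> weight 0 r -> weight 3 (pt ^+ k * r).
    by move=> k3 wr; apply: weight_le k3 _; rewrite -[k in weight k _]addn0; apply: weightM.
  by do !apply: weightD; [apply: weight_le wR0 | apply: (wptM 1%N) | apply: wptM | apply: wptM].
pose a : {poly {poly F}} := \sum_(j < 5) pt ^+ j * (A j)%:P.
have a_coef k : (5 <= k)%N -> a`_k = 0.
  apply: size_coef_eq0; apply: leq_trans (size_sum _ _ _) _; apply/bigmax_leqP => j _.
  apply: leq_trans (size_polyMleq _ _) _.
  have spt : (size pt <= 2)%N.
    rewrite (leq_trans (size_polyD _ _)) // geq_max size_polyC (leq_trans (leq_b1 _)) //=.
    by rewrite (leq_trans (size_polyMleq _ _)) // size_polyX size_polyC; case: (_ != _).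
  have := size_poly_exp_leq pt j; have := ltn_ord j; rewrite size_polyC.
  by move: (size pt) spt (size _) (_ != 0) => n n2 n' b jlt; nia.
set Z := \sum_(j < 5) 'X^j * A j in ZE.
have aE : eqX8 a (shift H Z * s - (t - pt) * rho).
  have -> : a = shift H Z * s - \sum_(j < 5) pt ^+ j * C j.
    rewrite /Z shift_sum mulr_suml -sumrB; apply: eq_bigr => j _.
    by rewrite shiftM shift_exp shiftX /C; ring.
  apply: eqX8B; first exact: eqX8_refl.
  rewrite !big_ord_recr big_ord0 /= add0r expr0 expr1 mul1r.
  have -> : C 0%N + pt * C 1%N + pt ^+ 2 * C 2 + pt ^+ 3 * C 3 + pt ^+ 4 * C 4
      = (t - pt) * rho + (C 0%N - t * R0).
    by rewrite /rho /R3 /R2 /R1 /R0; move: pt t => p0 t0; ring.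
  rewrite -[X in eqX8 _ X]addr0; apply: eqX8D; first exact: eqX8_refl.
  by rewrite -(subrr (C 0%N)); apply: eqX8B; first exact: eqX8_refl.
have tptE : t - pt = Pi%:P - H%:P * 'X.
  by rewrite /shift_pt /XqX rmorphB /=; ring.
have shPi : eqX8 (shift H Pi) (t - pt).
  rewrite /XqX shiftB shiftX; apply: eqX8B; last exact: eqX8_refl.
  by have := shift_Xq_pow 1; rewrite muln1.
have [z Hz] := shift_taylor1 H H.
have {}Hz : shift H H = H%:P * (1 + 'X * z) by rewrite Hz; ring.
have wz : weight 0 ('X * z).
  have -> : 'X * z = (1 + 'X * z) - 1 by ring.
  apply: weightD; last by apply: weightN; apply: (weight_nat _ 1).
  apply: (weight_cancel nzH); rewrite addn0 -Hz; apply: weight_shift => //.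
  by rewrite prednK // size_poly_gt0.
set w := 'X * z in Hz wz.
(* The inverse, modulo eps^8, of the quotient [1 + w] of [shift H H] by [H]. *)
pose iota := 1 - w + w ^+ 2 - w ^+ 3 + w ^+ 4 - w ^+ 5 + w ^+ 6 - w ^+ 7.
have w_iota : weight 0 iota.
  rewrite /iota; do ![apply: weightD | apply: weightN]; try exact: weight0X.
    exact: (weight_nat _ 1).
  exact: wz.
have iotaE : eqX8 ((1 + w) * iota) 1.
  rewrite /iota inv1_trunc; exists (- z ^+ 8); rewrite /w exprMn; ring.
have HZ : eqX8 (H%:P * (shift H Z + 1)) ((t - pt) * shift H E * iota).
  have ZE' : shift H H * (shift H Z + 1) = shift H Pi * shift H E.
    by rewrite -(shift1 H) -shiftD -!shiftM ZE.
  apply: (@eqX8_trans _ _ (H%:P * (shift H Z + 1) * ((1 + w) * iota))).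
    rewrite -[X in eqX8 X _]mulr1; apply: eqX8Ml; exact: eqX8_sym.
  have -> : H%:P * (shift H Z + 1) * ((1 + w) * iota)
     = shift H Pi * shift H E * iota by rewrite -ZE' Hz; ring.
  by do 2!apply: eqX8Mr.
pose Gam : {poly {poly F}} := shift H E * iota * s - H%:P * rho.
(* The first term gets 13 from the degree of [E], the second 10 + 3 from [H] and [rho]. *)
have wGam : weight 13 Gam.
  apply: weightD; last first.
    apply: weightN; apply: (@weightM _ 10 3) => //.
    by apply: weightC.
  rewrite -mulrA -[13%N]addn0; apply: weightM; last exact: weight0M.
  exact: weight_shift.
have Ha : eqX8 (H%:P * a) ((Pi%:P - H%:P * 'X) * Gam - H%:P * s).
  apply: eqX8_trans (eqX8Ml _ aE) _; rewrite -tptE.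
  have -> : H%:P * (shift H Z * s - (t - pt) * rho) =
     H%:P * (shift H Z + 1) * s - (H%:P * s + (t - pt) * H%:P * rho) by ring.
  have -> : (t - pt) * Gam - H%:P * s =
     (t - pt) * shift H E * iota * s - (H%:P * s + (t - pt) * H%:P * rho).
    by rewrite /Gam; ring.
  by apply: eqX8B; [apply: eqX8Mr | apply: eqX8_refl].
clearbody Gam.
have coefE k : (4 < k)%N -> (k < 8)%N ->
    Pi * Gam`_k = H * (s`_k + Gam`_k.-1).
  move=> k5 k8; have := eqX8_coef Ha k8.
  rewrite coefCM a_coef // mulr0 mulrBl -[H%:P * 'X * _]mulrA !coefB coefCM.
  rewrite (coefCM H ('X * Gam)) (coefCM H s) coefXM; case: k k5 {k8} => //= k _ E0.
  move/esym/eqP: E0; rewrite -addrA -opprD subr_eq0 => /eqP ->.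
  by rewrite mulrDr addrC.
have sizeH (f : {poly F}) c : (size f <= c)%N -> (size (H * f)%R <= 10 + c)%N.
  move=> sf; rewrite (leq_trans (size_polyMleq _ _)) //.
  by apply: (@leq_trans (11 + c).-1); [rewrite -!subn1 leq_sub2r // leq_add | lia].
(* In degree 5 the right-hand side of [coefE] has degree at most 10 + 49 in T. In degrees 6 and 7 it
   reduces to H s_k, of degree at most 10 + 63. All this is below q. *)
have G5 : Gam`_5 = 0.
  apply: size_eq0_of_XqX (coefE 5 isT isT).
  apply: (@leq_trans (10 + 50)); last by apply: leq_trans q_ge.
  apply: sizeH; rewrite (leq_trans (size_polyD _ _)) // geq_max /=.
  by rewrite (wGam 4) // (leq_trans (ws 5 isT)).
have next k : (5 < k)%N -> (k < 8)%N -> Gam`_k.-1 = 0 -> Gam`_k = 0 /\ s`_k = 0.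
  move=> k5 k8 G0; have := coefE k (ltnW k5) k8; rewrite G0 addr0 => E0.
  have Gk : Gam`_k = 0.
    apply: size_eq0_of_XqX E0.
    apply: (@leq_trans (10 + 64)); last by apply: leq_trans q_ge.
    by apply: sizeH; apply: leq_trans (ws k k8) _; lia.
  split=> //; move/eqP: E0; rewrite Gk mulr0 eq_sym mulf_eq0 (negPf nzH) /=.
  by move/eqP.
have [G6 ->] := next 6%N isT isT G5.
by have [_ ->] := next 7%N isT isT G6.
Qed.

End Core.

(** Modulo [D] the argument of the square root reduces to c D' eps with c = 1/4, so the coefficients
    of degree 6 and 7 become -84 (c D')^6 and 264 (c D')^7. As they vanish, [D] divides a power of
    D'. *)
Theorem dvdp_deriv_exp7 (F : finFieldType) (D G : {poly F}) m :
  (89 <= #|F|)%N -> #|F| = m.*2.+1 -> (2 : F) != 0 -> (3 : F) != 0 ->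
  G != 0 -> (1 < size D)%N -> (size (D * G)%R <= 11)%N ->
  (forall s, (D * G).[s] = 0 \/ D.[s] ^+ m = -1) ->
  D %| D^`() ^+ 7.
Proof.
move=> q_ge q_odd nz2 nz3 nzG sD sH valD.
have [s [v [sE [Q vE] ws Ds]]] := sqrt_series q_ge q_odd nz2 sD sH.
have [] := sqrt_series_coef0 q_ge q_odd nz2 nzG sD sH valD ws Ds.
rewrite !coef_scale.
move/eqP; rewrite mulf_eq0 expf_eq0 (negPf nzG) /= => /eqP s6.
move/eqP; rewrite mulf_eq0 expf_eq0 (negPf nzG) /= => /eqP s7.
set c : {poly F} := (2^-1)%:P ^+ 2 in sE; set D' := D^`() in vE *.
have nzc : c * 2 ^+ 2 = 1.
  by rewrite /c -(polyC_natr _ 2) -exprMn -polyCM mulVf // expr1n.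
clearbody c.
have [e sE'] := sqrt14D ((c * D')%:P * 'X) (D%:P * (c%:P * ('X * ('X * Q)))).
have {}sE : s = sqrt14 ((c * D')%:P * 'X) + D%:P * (c%:P * ('X * ('X * Q)) * e).
  rewrite mulrA -sE' sE vE; congr sqrt14; rewrite (polyCM c); ring.
have [c6 c7] := coef_sqrt14 (c * D').
have dvd k (n : F) : n != 0 -> D %| (n%:P * (c * D') ^+ k) -> D %| D' ^+ k.
  move=> nzn /(dvdp_mull ((n^-1)%:P * (2 ^+ 2) ^+ k)).
  suff -> : (n^-1)%:P * (2 ^+ 2) ^+ k * (n%:P * (c * D') ^+ k) = D' ^+ k by [].
  rewrite mulrACA -polyCM mulVf // mul1r -exprMn mulrCA mulrA nzc mul1r //.
move: s6 s7; rewrite sE !(coefD (sqrt14 _)) !coefCM c6 c7 => s6 s7.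
(* Since 84 = 2^2 3 7, degree 6 gives nothing in characteristic 7; there 264 is invertible. *)
have [c7_0 | nz7] := eqVneq (7 : F) 0.
  apply: (dvd 7%N 264).
    have -> : 264 = 2 * 2 ^+ 2 * (5 * 7 - 2) :> F by ring.
    by rewrite c7_0 mulr0 sub0r !mulf_neq0 // oppr_eq0.
  have -> : (264)%:P * (c * D') ^+ 7 = - (D * (c%:P * ('X * ('X * Q)) * e)`_7).
    by apply/eqP; rewrite -addr_eq0 polyC_natr s7.
  by rewrite dvdpNr dvdp_mulIl.
have D6 : D %| D' ^+ 6.
  apply: (dvd 6%N 84).
    have -> : 84 = 2 ^+ 2 * 3 * 7 :> F by ring.
    by rewrite !mulf_neq0.
  have -> : (84)%:P * (c * D') ^+ 6 = D * (c%:P * ('X * ('X * Q)) * e)`_6.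
    by apply/eqP; rewrite -subr_eq0 polyC_natr -oppr_eq0 opprB addrC s6.
  by rewrite dvdp_mulIl.
by rewrite exprS dvdp_mull.
Qed.

(** * From Taylor coefficients to a constant times a square *)

Section NonsquareValues.
Variables (F : finFieldType) (m : nat).
Hypothesis q_odd : #|F| = m.*2.+1.

(** Euler's criterion. If X^m - 1 had a nonsquare root, its cofactor [R] of degree m - 1 would
    vanish at all nonzero squares, and R (X^2), of degree 2m - 2, would have 2m roots. *)
Lemma nonsquare_exp (x : F) : (forall y, x <> y ^+ 2) -> x ^+ m = -1.
Proof.
move=> nsq.
have nzx : x != 0 by apply/eqP => x0; apply: (nsq 0); rewrite x0 expr0n.
have exp_2m (s : F) : s != 0 -> (s ^+ 2) ^+ m = 1.
  move=> nzs; apply: (mulfI nzs); rewrite mulr1 -exprM mul2n -exprS -q_odd.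
  exact: expf_card.
have /eqP : (x ^+ m) ^+ 2 = 1 by rewrite -exprM mulnC exprM exp_2m.
rewrite sqrf_eq1 => /orP[/eqP xm|/eqP //].
have m_gt0 : (0 < m)%N by have := finNzRing_gt1 F; rewrite q_odd; lia.
pose P : {poly F} := 'X^m - 1.
have [R PE] : exists R, P = R * ('X - x%:P).
  by apply/factor_theorem; rewrite /root /P !hornerE xm subrr.
have sP : size P = m.+1 by rewrite /P -polyC1 size_XnsubC.
have nzP : P != 0 by rewrite -size_poly_gt0 sP.
have nzR : R != 0 by apply: contraNneq nzP => R0; rewrite PE R0 mul0r.
have sR : size R = m.
  by apply: succn_inj; rewrite -sP PE size_Mmonic ?monicXsubC // size_XsubC addn2.
have nzR2 : R \Po 'X^2 != 0 by rewrite comp_poly_eq0 // size_polyXn.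
have roots : all (root (R \Po 'X^2)) [seq s <- enum F | s != 0].
  apply/allP => s; rewrite mem_filter => /andP[nzs _].
  rewrite /root horner_comp hornerXn.
  have : P.[s ^+ 2] == 0 by rewrite /P !hornerE exp_2m // subrr.
  rewrite PE hornerM !hornerE mulf_eq0 => /orP[//|].
  by rewrite subr_eq0 => /eqP sx; case: (nsq s).
have := max_poly_roots nzR2 roots (filter_uniq _ (enum_uniq _)).
rewrite size_filter.
have -> : count (fun s : F => s != 0) (enum F) = m.*2.
  have := count_predC (pred1 (0 : F)) (enum F).
  rewrite -cardE q_odd count_uniq_mem ?enum_uniq // mem_enum.
  by move=> [].
have := size_comp_poly_leq R 'X^2; rewrite size_polyXn sR.
by move: (size _) => n; lia.
Qed.

(** Only exponents divisible by p occur, and the power with exponent q / p is a p-th root of each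
    coefficient. *)
Lemma deriv_eq0_expp (U : {poly F}) p :
  prime p -> p \in [pchar F] -> U^`() = 0 -> exists W, U = W ^+ p.
Proof.
move=> p_pr pF U'0.
have pFP : p \in [pchar {poly F}] by rewrite pchar_poly.
pose e := (#|F| %/ p)%N.
have eP : (e * p = #|F|)%N.
  have := card_pprimeChar pF; case: (logn _ _) => [|k] cF.
    by have := finNzRing_gt1 F; rewrite cF.
  by rewrite /e cF expnS mulKn ?prime_gt0 // mulnC.
exists (\sum_(i < size U) (U`_(p * i) ^+ e)%:P * 'X^i).
rewrite -(pFrobenius_autE pFP) rmorph_sum /=; apply/polyP => k.
rewrite coef_sum.
under eq_bigr => i _.
  rewrite pFrobenius_autE exprMn -rmorphXn /= -!exprM eP expf_card coefCM coefXn.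
  over.
have [/dvdnP[j ->] | ndvd] := boolP (p %| k)%N.
  have [ltj | gej] := ltnP j (size U).
    rewrite (bigD1 (Ordinal ltj)) //= eqxx mulr1 big1 ?addr0; first by rewrite mulnC.
    move=> i /negPf; rewrite -val_eqE /= => nij.
    by rewrite eqn_mul2r [j == _]eq_sym nij eqn0Ngt prime_gt0 ?mulr0.
  rewrite nth_default; last by apply: leq_trans gej _; rewrite leq_pmulr ?prime_gt0.
  rewrite big1 // => i _; rewrite eqn_mul2r eqn0Ngt prime_gt0 //=.
  by rewrite gtn_eqF ?mulr0 //; apply: leq_trans gej.
rewrite big1 => [|i _]; last first.
  by case: eqP ndvd => [->|]; rewrite ?dvdn_mull ?mulr0.
case: k ndvd => [|k] ndvd; first by rewrite dvdn0 in ndvd.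
have := coef_deriv U k; rewrite U'0 coef0 => /esym/eqP.
rewrite -mulr_natr mulf_eq0 => /orP[/eqP //|].
by rewrite -(dvdn_pcharf pF) (negPf ndvd).
Qed.

(** Let [g] be the gcd of D and D', which is not constant, and D = V g. If [V] is constant, D' = 0
    and D is a p-th power. If [g] and [V] share a factor, its square divides D. Otherwise D' is
    congruent to g V' modulo V, so the smaller polynomial [V] inherits the hypothesis. *)
Lemma square_factor (D : {poly F}) n : (1 < size D)%N -> D %| D^`() ^+ n ->
  exists U V : {poly F}, (1 < size U)%N /\ D = U ^+ 2 * V.
Proof.
have [k] := ubnP (size D); elim: k D => // k IHk D sDk sD Ddvd.
have nzD : D != 0 by rewrite -size_poly_gt0 ltnW.
set g := gcdp D D^`(); have /dvdpP[V DE] : g %| D by apply: dvdp_gcdl.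
have /andP[nzV nzg] : (V != 0) && (g != 0) by rewrite -negb_or -mulf_eq0 -DE.
have sg : (1 < size g)%N.
  rewrite ltn_neqAle size_poly_gt0 nzg andbT eq_sym; apply/negP => cop.
  have /(coprimep_expr n) : coprimep D D^`() by [].
  rewrite coprimep_sym => /coprimepP/(_ D Ddvd (dvdpp _)).
  by rewrite -size_poly_eq1 => /eqP sD1; rewrite sD1 in sD.
have sDE : (size D = (size V + size g).-1)%N by rewrite DE size_mul.
have [sV | sV] := leqP (size V) 1.
  have D'0 : D^`() = 0.
    have Dg : D %| D^`().
      apply: dvdp_trans (dvdp_gcdr D _); rewrite -/g DE (size1_polyC sV).
      by rewrite mul_polyC dvdpZl // -polyC_eq0 -(size1_polyC sV).
    apply/eqP; apply: contraLR (lt_size_deriv nzD) => nzD'; rewrite -leqNgt.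
    exact: dvdp_leq.
  have [p p_pr pF] := finPcharP F.
  have [W WE] := deriv_eq0_expp p_pr pF D'0.
  exists W, (W ^+ (p - 2)); split; last by rewrite -exprD subnKC ?prime_gt1.
  rewrite ltnNge; apply: contraL sD => /size1_polyC WC.
  by rewrite WE WC -rmorphXn /= size_polyC -leqNgt leq_b1.
have [cop | ncop] := boolP (coprimep g V); last first.
  set h := gcdp g V.
  have [/dvdpP[g' gE] /dvdpP[V' VE]] : h %| g /\ h %| V by rewrite dvdp_gcdl dvdp_gcdr.
  exists h, (V' * g'); split; last by rewrite DE gE VE; ring.
  rewrite ltn_neqAle eq_sym; apply/andP; split; first by [].
  by rewrite size_poly_gt0 gcdp_eq0 (negPf nzg).
have VdD' : V %| D^`() ^+ n by apply: dvdp_trans Ddvd; rewrite DE dvdp_mulr.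
have VdV' : V %| V^`() ^+ n.
  have : V %| (g * V^`()) ^+ n.
    rewrite -(dvdp_subr _ VdD') subrXX; apply: dvdp_mulr.
    have -> : D^`() - g * V^`() = V * g^`() by rewrite {1}DE derivM; ring.
    exact: dvdp_mulIl.
  by rewrite exprMn Gauss_dvdpr // coprimep_expr // coprimep_sym.
have sVk : (size V < k)%N.
  move: sDk; rewrite sDE; move: (size V) (size g) sV sg => a b; lia.
have [U [W [sU VE]]] := IHk V sVk sV VdV'.
by exists U, (W * g); split=> //; rewrite DE VE mulrA.
Qed.

Hypothesis q_ge : (89 <= #|F|)%N.
Hypothesis two_neq0 : (2 : F) != 0.
Hypothesis three_neq0 : (3 : F) != 0.

(** Write P = D G^2. As long as [D] is not constant it has a square factor, which moves into [G]. *)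
Theorem nonsquare_values (P : {poly F}) : (size P <= 11)%N ->
  (forall s y, P.[s] = y ^+ 2 -> y = 0) -> exists c G, P = c *: G ^+ 2.
Proof.
move=> sP nsqP; have [->|nzP] := eqVneq P 0; first by exists 0, 0; rewrite scale0r.
suff H k (D G : {poly F}) : (size D < k)%N -> P = D * G ^+ 2 ->
    exists c G, P = c *: G ^+ 2.
  by apply: (H _ P 1 (leqnn _)); rewrite expr1n mulr1.
elim: k D G => // k IHk D G sDk PE.
have /andP[nzD nzG] : (D != 0) && (G != 0).
  by move: nzP; rewrite PE mulf_eq0 expf_eq0 negb_or.
have [sD | sD] := leqP (size D) 1.
  by exists D`_0, G; rewrite PE {1}(size1_polyC sD) mul_polyC.
have sDG : (size (D * G)%R <= 11)%N.
  by apply: leq_trans sP; apply: dvdp_leq; rewrite // PE expr2 mulrA dvdp_mulIl.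
(* Where D G does not vanish, a square value of [D] would give [P] a nonzero square value. *)
have valD s : (D * G).[s] = 0 \/ D.[s] ^+ m = -1.
  have [->|nz] := eqVneq (D * G).[s] 0; [by left | right].
  apply: nonsquare_exp => z Dz; case/eqP: nz.
  by rewrite hornerM Dz expr2 -mulrA (nsqP s (z * G.[s])) ?mulr0 //
     PE hornerM horner_exp Dz exprMn.
have /(square_factor sD)[U [V [sU DE]]] :=
  dvdp_deriv_exp7 q_ge q_odd two_neq0 three_neq0 nzG sD sDG valD.
apply: (IHk V (U * G)); last by rewrite PE DE; ring.
have [nzU nzV] : U != 0 /\ V != 0.
  by move: nzD; rewrite DE mulf_eq0 expf_eq0 negb_or => /andP[].
rewrite ltnS in sDk; apply: leq_trans sDk.
rewrite DE expr2 -mulrA !size_mul ?mulf_neq0 //.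
by move: sU nzV; rewrite -size_poly_gt0; move: (size U) (size V) => a b; lia.
Qed.

End NonsquareValues.

(** * Points spanned by three points of the track *)

Section Coverage.
Variable F : finFieldType.
Implicit Types (x : nat -> F) (i : option (bool * F)).

(* A point of the track: [Some (false, t)] is the point of the curve at t,
   [Some (true, t)] the tangent point at t, and [None] the point at infinity. *)
Definition track_coord i (n : nat) : F :=
  match i with
  | Some (false, t) => t ^+ n
  | Some (true, t) => n%:R * t ^+ n.-1
  | None => (n == 4)%:R
  end.

(** The three points may coincide; [index_of_seq] makes them distinct in the end. *)
Definition covered x := exists i j k (a b c : F), forall n, (n < 5)%N ->
  x n = a * track_coord i n + b * track_coord j n + c * track_coord k n.

Lemma covered_scale (c : F) x : c != 0 -> covered (fun n => c * x n) -> covered x.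
Proof.
move=> nzc [i [j [k [a1 [a2 [a3 xE]]]]]].
exists i, j, k, (c^-1 * a1), (c^-1 * a2), (c^-1 * a3) => n n5.
by apply: (mulfI nzc); rewrite xE // !mulrDr !mulrA !mulfV ?mul1r.
Qed.

Lemma coveredI i j k (a b c : F) x :
  x 0%N = a * track_coord i 0 + b * track_coord j 0 + c * track_coord k 0 ->
  x 1%N = a * track_coord i 1 + b * track_coord j 1 + c * track_coord k 1 ->
  x 2 = a * track_coord i 2 + b * track_coord j 2 + c * track_coord k 2 ->
  x 3 = a * track_coord i 3 + b * track_coord j 3 + c * track_coord k 3 ->
  x 4 = a * track_coord i 4 + b * track_coord j 4 + c * track_coord k 4 ->
  covered x.
Proof.
by move=> *; exists i, j, k, a, b, c; case=> [|[|[|[|[|n]]]]].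
Qed.

(* The functional f |-> phi (f (T + e)), where phi (T ^ n) = x n. *)
Definition translate (e : F) x (n : nat) : F :=
  match n with
  | 0 => x 0%N
  | 1 => x 1%N + e * x 0%N
  | 2 => x 2 + 2 * e * x 1%N + e ^+ 2 * x 0%N
  | 3 => x 3 + 3 * e * x 2 + 3 * e ^+ 2 * x 1%N + e ^+ 3 * x 0%N
  | 4 => x 4 + 4 * e * x 3 + 6 * e ^+ 2 * x 2 + 4 * e ^+ 3 * x 1%N + e ^+ 4 * x 0%N
  | _ => 0
  end.

Lemma translateK e x n : (n < 5)%N -> translate (- e) (translate e x) n = x n.
Proof. by case: n => [|[|[|[|[|n]]]]] //= _; ring. Qed.

Lemma translate_track_coord e i n : (n < 5)%N ->
  translate e (track_coord i) n = track_coord (omap (fun bt => (bt.1, bt.2 + e)) i) n.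
Proof.
by case: i => [[[] t]|]; case: n => [|[|[|[|[|n]]]]] //= _; ring.
Qed.

Lemma translate_ext e x y : (forall n, (n < 5)%N -> x n = y n) ->
  forall n, (n < 5)%N -> translate e x n = translate e y n.
Proof. by move=> xy [|[|[|[|[|n]]]]] //= _; rewrite !xy. Qed.

Lemma translate_lin3 e (a b c : F) x y z n :
  translate e (fun n => a * x n + b * y n + c * z n) n =
  a * translate e x n + b * translate e y n + c * translate e z n.
Proof. by case: n => [|[|[|[|[|n]]]]] //=; ring. Qed.

(** Translation permutes the points of the track, fixing the one at infinity. *)
Lemma covered_translate e x : covered (translate e x) -> covered x.
Proof.
move=> [i [j [k [a [b [c xE]]]]]].
pose tr := omap (fun bt : bool * F => (bt.1, bt.2 - e)).
exists (tr i), (tr j), (tr k), a, b, c => n n5.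
rewrite -(translateK e x n5) (translate_ext _ xE n5) translate_lin3.
by rewrite !translate_track_coord.
Qed.

End Coverage.

(** * Cubic functionals as combinations of two evaluations *)

Section BinaryCubic.

(** The discriminant of a quadratic whose coefficients are, up to sign, the minors of the Hankel
    matrix with rows p0, p1, p2 and p1, p2, p3. *)
Definition cubic_disc (R : comNzRingType) (p0 p1 p2 p3 : R) :=
  (p1 * p2 - p0 * p3) ^+ 2 - 4 * (p2 ^+ 2 - p1 * p3) * (p1 ^+ 2 - p0 * p2).

Variable F : fieldType.

Definition cubic_eval (u : option F) (n : nat) : F :=
  if u is Some t then t ^+ n else (n == 3)%:R.

(* The points u and v are the roots of the quadratic form apolar to p. *)
Lemma cubic_two_points (p : nat -> F) (y : F) : (2 : F) != 0 -> y != 0 ->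
  cubic_disc (p 0%N) (p 1%N) (p 2) (p 3) = y ^+ 2 ->
  exists u v (a b : F), forall n, (n < 4)%N ->
    p n = a * cubic_eval u n + b * cubic_eval v n.
Proof.
move=> nz2 nzy; rewrite /cubic_disc.
set A := _ - p 0%N * p 3; set C := p 2 ^+ 2 - _; set Dl := _ - p 0%N * p 2 => yE.
have rec2 : Dl * p 2 = A * p 1%N - C * p 0%N by rewrite /Dl /A /C; ring.
have rec3 : Dl * p 3 = A * p 2 - C * p 1%N by rewrite /Dl /A /C; ring.
(* If [Dl] vanishes, one root of the apolar quadratic is at infinity. *)
have [Dl0 | nzDl] := eqVneq Dl 0.
  have nzA : A != 0.
    apply: contraNneq nzy => A0; rewrite -sqrf_eq0 -yE Dl0 A0; apply/eqP; ring.
  have nzp0 : p 0%N != 0.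
    apply: contraNneq nzA => p0; move/eqP: Dl0; rewrite /Dl p0 mul0r subr0.
    by rewrite sqrf_eq0 => /eqP p1; rewrite /A p0 p1 !mul0r subrr.
  have p2E : p 2 = p 1%N ^+ 2 / p 0%N.
    by apply: (mulfI nzp0); move/eqP: Dl0; rewrite subr_eq0 => /eqP <-; field.
  exists (Some (p 1%N / p 0%N)), None, (p 0%N), (p 3 - p 0%N * (p 1%N / p 0%N) ^+ 3).
  by case=> [|[|[|[|n]]]] //= _; rewrite ?p2E; field.
clearbody A C Dl.
pose u := (A + y) / (2 * Dl); pose v := (A - y) / (2 * Dl).
have nzuv : u - v != 0.
  have -> : u - v = y / Dl by rewrite /u /v; field; rewrite nzDl nz2.
  by rewrite mulf_neq0 ?invr_neq0.
have uDv : u + v = A / Dl by rewrite /u /v; field; rewrite nzDl nz2.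
have nz4 : (4 : F) != 0.
  have -> : (4 : F) = 2 * 2 by ring.
  by rewrite mulf_neq0.
have uMv : u * v = C / Dl.
  transitivity ((A ^+ 2 - y ^+ 2) / (4 * Dl ^+ 2)).
    by rewrite /u /v; field; rewrite nzDl nz2 nz4.
  by rewrite -yE; field; rewrite nzDl nz4.
have {}rec2 : p 2 = (u + v) * p 1%N - u * v * p 0%N.
  by apply: (mulfI nzDl); rewrite rec2 uDv uMv; field.
have {}rec3 : p 3 = (u + v) * p 2 - u * v * p 1%N.
  by apply: (mulfI nzDl); rewrite rec3 uDv uMv; field.
exists (Some u), (Some v), ((p 1%N - v * p 0%N) / (u - v)), ((u * p 0%N - p 1%N) / (u - v)).
by case=> [|[|[|[|n]]]] //= _; rewrite ?rec3 ?rec2; field.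
Qed.

End BinaryCubic.

Section Families.
Variable F : finFieldType.
Hypothesis nz2 : (2 : F) != 0.
Hypothesis nz3 : (3 : F) != 0.
Implicit Types x : nat -> F.

Lemma nz_succ n : (n < 4)%N -> (n.+1%:R : F) != 0.
Proof.
case: n => [|[|[|[|n]]]] // _; first exact: oner_neq0.
have -> : (4 : F) = 2 * 2 by ring.
exact: mulf_neq0.
Qed.

(* x is the functional phi, and the p n are the values of the cubic functional
   f |-> phi ((T - s) * f). *)
Lemma covered_secants (s y : F) x : y != 0 ->
  cubic_disc (x 1%N - s * x 0%N) (x 2 - s * x 1%N) (x 3 - s * x 2) (x 4 - s * x 3)
    = y ^+ 2 ->
  covered x.
Proof.
move=> nzy yE; pose p n := x n.+1 - s * x n.
have [u [v [a [b pE]]]] := @cubic_two_points F p y nz2 nzy yE.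
(* On (T - s) f, the evaluation at t gives (t - s) f (t), the derivative at s gives f (s), and the
   point at infinity gives the leading coefficient of f. *)
have lift (w : option F) : exists i (c : F), forall n, (n < 4)%N ->
    c * track_coord i n.+1 - s * (c * track_coord i n) = cubic_eval w n.
  case: w => [t|]; last first.
    by exists None, 1 => n n4 /=; rewrite eqSS (ltn_eqF n4) !mulr0 subr0 mul1r.
  have [->|nzts] := eqVneq t s.
    exists (Some (true, s)), 1 => [[|n]] _ /=; first by ring.
    by rewrite exprS -(natr1 n.+1); ring.
  exists (Some (false, t)), (t - s)^-1 => n _ /=.
  by rewrite exprS; field; rewrite subr_eq0.
have [i [c iE]] := lift u; have [j [d jE]] := lift v.
pose w n := a * c * track_coord i n + b * d * track_coord j n.
(* Both sides agree on multiples of T - s, so [x] and [w] differ by a multiple of the evaluation at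
   s. *)
have xE n : (n < 5)%N -> x n = (x 0%N - w 0%N) * s ^+ n + w n.
  elim: n => [|n IHn] n5; first by rewrite expr0; ring.
  have -> : x n.+1 = p n + s * x n by rewrite /p; ring.
  rewrite pE // -iE // -jE // IHn 1?ltnW // exprS /w; ring.
exists (Some (false, s)), i, j, (x 0%N - w 0%N), (a * c), (b * d) => n n5.
by rewrite xE // /w /=; ring.
Qed.

(* The p n are the values of the cubic functional sending f to phi of the
   primitive of f vanishing at a; it turns evaluations into tangent points. *)
Lemma covered_tangents (a y : F) x : y != 0 ->
  cubic_disc (x 1%N - a * x 0%N) ((x 2 - a ^+ 2 * x 0%N) / 2)
    ((x 3 - a ^+ 3 * x 0%N) / 3) ((x 4 - a ^+ 4 * x 0%N) / 4) = y ^+ 2 ->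
  covered x.
Proof.
move=> nzy yE; pose p n := (x n.+1 - a ^+ n.+1 * x 0%N) / n.+1%:R.
have [|u [v [b [c pE]]]] := @cubic_two_points F p y nz2 nzy.
  by rewrite /p expr1 divr1.
have lift (w : option F) : exists i (c : F), c * track_coord i 0 = 0 /\
    forall n, (n < 4)%N -> c * track_coord i n.+1 = n.+1%:R * cubic_eval w n.
  case: w => [t|].
    by exists (Some (true, t)), 1; split=> [|n _] /=; rewrite ?mul0r ?mulr0 ?mul1r.
  exists None, 4; split=> [|n _] /=; first by rewrite mulr0.
  by rewrite eqSS; case: eqP => [->|]; rewrite ?mulr0.
have [i [d [i0 iE]]] := lift u; have [j [e [j0 jE]]] := lift v.
exists (Some (false, a)), i, j, (x 0%N), (b * d), (c * e) => -[|n] n5 /=.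
  by rewrite -!mulrA i0 j0; ring.
rewrite -[b * d * _]mulrA -[c * e * _]mulrA iE // jE //.
have -> : x n.+1 = n.+1%:R * p n + a ^+ n.+1 * x 0%N.
  by rewrite /p mulrC divfK ?nz_succ // subrK.
by rewrite pE //; ring.
Qed.

Lemma nonsquare_or (P : {poly F}) (Q : Prop) :
  (forall s y, y != 0 -> P.[s] = y ^+ 2 -> Q) ->
  Q \/ (forall s y, P.[s] = y ^+ 2 -> y = 0).
Proof.
move=> PQ; have [/existsP[s /existsP[y /andP[nzy /eqP sy]]]|] :=
  boolP [exists s, exists y, (y != 0) && (P.[s] == y ^+ 2)].
  by left; apply: PQ sy.
rewrite negb_exists => /forallP nsq; right=> s y sy; have := nsq s.
by rewrite negb_exists => /forallP/(_ y); rewrite sy eqxx andbT negbK => /eqP.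
Qed.

End Families.

(** * Polynomials of degree ten that are squares of quintics *)

Section SquareOfQuintic.
Variable F : fieldType.

(** Comparing leading coefficients, [c] is the inverse square of that of [G]; the [h] are the lower
    coefficients of the monic multiple of [G]. *)
Lemma monic_decic_square (a0 a1 a2 a3 a4 a5 a6 a7 a8 a9 c : F) (G : {poly F}) :
  'X^10 + a9%:P * 'X^9 + a8%:P * 'X^8 + a7%:P * 'X^7 + a6%:P * 'X^6
    + a5%:P * 'X^5 + a4%:P * 'X^4 + a3%:P * 'X^3 + a2%:P * 'X^2 + a1%:P * 'X
    + a0%:P = c *: G ^+ 2 ->
  exists h0 h1 h2 h3 h4 : F, [/\ a9 = 2 * h4, a8 = 2 * h3 + h4 ^+ 2,
    a7 = 2 * h2 + 2 * h3 * h4, a6 = 2 * h1 + 2 * h2 * h4 + h3 ^+ 2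
    & a5 = 2 * h0 + 2 * h1 * h4 + 2 * h2 * h3] /\
  [/\ a4 = 2 * h0 * h4 + 2 * h1 * h3 + h2 ^+ 2,
    a3 = 2 * h0 * h3 + 2 * h1 * h2, a2 = 2 * h0 * h2 + h1 ^+ 2
    & a0 = h0 ^+ 2].
Proof.
set P := _ + a0%:P => PE.
pose s := [:: a0; a1; a2; a3; a4; a5; a6; a7; a8; a9; 1].
have Ps k : P`_k = s`_k.
  rewrite /P !(coefD, coefCM, coefC, coefXn, coefX).
  case: k => [|[|[|[|[|[|[|[|[|[|[|k]]]]]]]]]]] /=;
    by rewrite ?(mulr0, mulr1, add0r, addr0) // nth_nil.
have sP : (size P <= 11)%N by apply/leq_sizeP => k k11; rewrite Ps nth_default.
have P10 : P`_10 = 1 by rewrite Ps.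
clearbody P.
have nzP : P != 0 by apply: contra_eq_neq P10 => ->; rewrite coef0 eq_sym oner_eq0.
have [nzc nzG] : c != 0 /\ G != 0.
  by apply/andP; move: nzP; rewrite PE scaler_eq0 expf_eq0 negb_or.
have sG : (size G <= 6)%N.
  move: sP (nzG); rewrite PE size_scale // expr2 size_mul // -size_poly_gt0.
  by move: (size G) => n; lia.
have G0 k : (6 <= k)%N -> G`_k = 0 by move=> k6; exact: (size_coef_eq0 sG k6).
have Gz := (G0 6%N isT, G0 7%N isT, G0 8%N isT, G0 9%N isT, G0 10%N isT).
have E k : P`_k = c * \sum_(j < k.+1) G`_j * G`_(k - j).
  by rewrite PE coefZ expr2 coefM.
have E10 : c * (G`_5 * G`_5) = 1.
  by rewrite -P10 E !big_ord_recr big_ord0 /= !Gz !(mul0r, mulr0, add0r, addr0).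
have nzg5 : G`_5 != 0.
  by apply: contra_eq_neq E10 => ->; rewrite mulr0 mulr0 eq_sym oner_eq0.
have cE : c = (G`_5)^-1 ^+ 2.
  by rewrite -[LHS]mulr1 -(mulfV nzg5) -[RHS]mul1r -E10; field.
exists (G`_0 / G`_5), (G`_1 / G`_5), (G`_2 / G`_5), (G`_3 / G`_5), (G`_4 / G`_5).
move: (Ps 0%N) (Ps 2) (Ps 3) (Ps 4) (Ps 5) (Ps 6) (Ps 7) (Ps 8) (Ps 9) => /=.
do 9![move=> <-].
by do !split; rewrite E !big_ord_recr big_ord0 /= ?Gz cE; field.
Qed.

End SquareOfQuintic.

Lemma imaginary_secant_disc (S R : comNzRingType) (f : {rmorphism S -> R})
    (T : R) (d v : S) :
  cubic_disc (12 * (f v - T)) (6 * (f d - T ^+ 2)) (4 * (f (d * v) - T ^+ 3))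
    (3 * (f (d ^+ 2) - T ^+ 4))
  = 48 * (T ^+ 10 + f (- (10 * v)) * T ^+ 9 + f (27 * v ^+ 2 + 18 * d) * T ^+ 8
  + f (- (120 * v * d)) * T ^+ 7 + f (84 * v ^+ 2 * d + 126 * d ^+ 2) * T ^+ 6
  + f (- (252 * v * d ^+ 2)) * T ^+ 5 + f (210 * v ^+ 2 * d ^+ 2) * T ^+ 4
  + f (72 * v * d ^+ 3 - 192 * v ^+ 3 * d ^+ 2) * T ^+ 3
  + f (180 * v ^+ 2 * d ^+ 3 - 135 * d ^+ 4) * T ^+ 2
  + f (54 * v * d ^+ 4 - 64 * v ^+ 3 * d ^+ 3) * T
  + f (64 * v ^+ 4 * d ^+ 3 - 117 * v ^+ 2 * d ^+ 4 + 54 * d ^+ 5)).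
Proof. by rewrite /cubic_disc; ring. Qed.

Lemma cubic_discZ (R : comNzRingType) (k p0 p1 p2 p3 : R) :
  cubic_disc (k * p0) (k * p1) (k * p2) (k * p3) = k ^+ 4 * cubic_disc p0 p1 p2 p3.
Proof. by rewrite /cubic_disc; ring. Qed.

Lemma rmorph_cubic_disc (R S : comNzRingType) (f : {rmorphism R -> S})
    (p0 p1 p2 p3 : R) :
  f (cubic_disc p0 p1 p2 p3) = cubic_disc (f p0) (f p1) (f p2) (f p3).
Proof. by rewrite /cubic_disc; ring. Qed.

(** The first five equations determine the [h]. From the next three a factor (v^2 - d)^2 splits off,
    leaving [r4], [r3] and [r2]. If v = 0, the constant term gives 54 d^5 = 0. In characteristic 5,
    [r4] gives 2 v^2 = 0. Otherwise [r3] gives v^2 = - 3 d, whence 103 and 9972 vanish by [r4] and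
    [r2], and with them 8. *)
Lemma imaginary_secant_not_square (F : fieldType) (d v h0 h1 h2 h3 h4 : F) :
  (2 : F) != 0 -> (3 : F) != 0 -> d != 0 -> v ^+ 2 != d ->
  - (10 * v) = 2 * h4 ->
  27 * v ^+ 2 + 18 * d = 2 * h3 + h4 ^+ 2 ->
  - (120 * v * d) = 2 * h2 + 2 * h3 * h4 ->
  84 * v ^+ 2 * d + 126 * d ^+ 2 = 2 * h1 + 2 * h2 * h4 + h3 ^+ 2 ->
  - (252 * v * d ^+ 2) = 2 * h0 + 2 * h1 * h4 + 2 * h2 * h3 ->
  210 * v ^+ 2 * d ^+ 2 = 2 * h0 * h4 + 2 * h1 * h3 + h2 ^+ 2 ->
  72 * v * d ^+ 3 - 192 * v ^+ 3 * d ^+ 2 = 2 * h0 * h3 + 2 * h1 * h2 ->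
  180 * v ^+ 2 * d ^+ 3 - 135 * d ^+ 4 = 2 * h0 * h2 + h1 ^+ 2 ->
  64 * v ^+ 4 * d ^+ 3 - 117 * v ^+ 2 * d ^+ 4 + 54 * d ^+ 5 = h0 ^+ 2 ->
  False.
Proof.
move=> nz2 nz3 nzd nzvd e9 e8 e7 e6 e5 e4 e3 e2 e0.
have h4E : h4 = - (5 * v).
  by apply: (mulfI nz2); rewrite -e9; ring.
have h3E : h3 = v ^+ 2 + 9 * d.
  apply: (mulfI nz2); have -> : 2 * h3 = 27 * v ^+ 2 + 18 * d - h4 ^+ 2 by rewrite e8; ring.
  by rewrite h4E; ring.
have h2E : h2 = 5 * v ^+ 3 - 15 * v * d.
  apply: (mulfI nz2); have -> : 2 * h2 = - (120 * v * d) - 2 * h3 * h4 by rewrite e7; ring.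
  by rewrite h4E h3E; ring.
have h1E : 2 * h1 = 49 * v ^+ 4 - 84 * v ^+ 2 * d + 45 * d ^+ 2.
  have -> : 2 * h1 = 84 * v ^+ 2 * d + 126 * d ^+ 2 - 2 * h2 * h4 - h3 ^+ 2 by rewrite e6; ring.
  by rewrite h4E h3E h2E; ring.
have h0E : 2 * h0 = 235 * v ^+ 5 - 480 * v ^+ 3 * d + 243 * v * d ^+ 2.
  have -> : 2 * h0 = - (252 * v * d ^+ 2) - (2 * h1) * h4 - 2 * h2 * h3 by rewrite e5; ring.
  by rewrite h4E h3E h2E h1E; ring.
have nzw2 : (v ^+ 2 - d) ^+ 2 != 0 by rewrite expf_neq0 // subr_eq0.
have r4 : 367 * v ^+ 2 - 135 * d = 0.
  apply: (mulfI nzw2); rewrite mulr0; apply: (mulfI nz3); rewrite mulr0.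
  transitivity (210 * v ^+ 2 * d ^+ 2 - ((2 * h0) * h4 + (2 * h1) * h3 + h2 ^+ 2)).
    by rewrite h4E h3E h2E h1E h0E; ring.
  by rewrite e4; ring.
have r3 : 480 * (v * (v ^+ 2 + 3 * d)) = 0.
  apply: (mulfI nzw2); rewrite mulr0.
  transitivity ((2 * h0) * h3 + (2 * h1) * h2
    - (72 * v * d ^+ 3 - 192 * v ^+ 3 * d ^+ 2)).
    by rewrite h3E h2E h1E h0E; ring.
  by rewrite e3; ring.
have r2 : 7101 * (v ^+ 2) ^+ 2 - 17730 * v ^+ 2 * d + 2565 * d ^+ 2 = 0.
  apply: (mulfI nzw2); rewrite mulr0.
  transitivity (4 * ((2 * h0) * h2) + (2 * h1) ^+ 2
    - 4 * (180 * v ^+ 2 * d ^+ 3 - 135 * d ^+ 4)).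
    by rewrite h2E h1E h0E; ring.
  by rewrite e2; ring.
have nz_prod (k : F) : k * d = 0 -> k = 0.
  by move/eqP; rewrite mulf_eq0 (negPf nzd) orbF => /eqP.
have [v0 | nzv] := eqVneq v 0.
  have h00 : h0 = 0 by apply: (mulfI nz2); rewrite h0E v0; ring.
  move: e0; rewrite v0 h00 => e0.
  have : 2 * 3 ^+ 3 * d ^+ 5 == 0.
    have -> : 2 * 3 ^+ 3 * d ^+ 5 = 64 * 0 ^+ 4 * d ^+ 3 - 117 * 0 ^+ 2 * d ^+ 4 + 54 * d ^+ 5 by ring.
    by rewrite e0 expr0n.
  by apply/negP; rewrite !mulf_neq0 ?expf_neq0.
have [five0 | nz5] := eqVneq (5 : F) 0.
  have : 2 * v ^+ 2 == 0.
    have -> : 2 * v ^+ 2 = 367 * v ^+ 2 - 135 * d - 5 * (73 * v ^+ 2 - 27 * d) by ring.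
    by rewrite r4 five0 mul0r subrr.
  by apply/negP; rewrite mulf_neq0 ?expf_neq0.
have vE : v ^+ 2 = - (3 * d).
  apply/eqP; rewrite -addr_eq0; move/eqP: r3.
  have -> : 480 = 2 ^+ 5 * 3 * 5 :> F by ring.
  have nz480 : 2 ^+ 5 * 3 * 5 != 0 :> F by rewrite !mulf_neq0 ?expf_neq0.
  by rewrite !(mulf_eq0 _ (v * _)) (mulf_eq0 v) (negPf nz480) (negPf nzv).
have p103 : 103 = 0 :> F.
  apply: nz_prod; apply: (mulfI nz2); apply: (mulfI nz2); apply: (mulfI nz3).
  apply: oppr_inj; rewrite !mulr0 oppr0 -r4 vE; ring.
have p9972 : 9972 = 0 :> F.
  apply: (nz_prod); apply: (nz_prod); apply: (mulfI nz2); apply: (mulfI nz2).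
  by apply: (mulfI nz3); rewrite !mulr0 -r2 vE; ring.
have : 2 ^+ 3 == 0 :> F.
  have -> : 2 ^+ 3 = 103 - 5 * (103 * 97 - 9972) :> F by ring.
  by rewrite p103 p9972 mul0r subrr mulr0 subrr.
by apply/negP; rewrite expf_neq0.
Qed.

(** * Two special families of points *)

Section SpecialPoints.
Variable F : finFieldType.
Variable m : nat.
Hypothesis q_odd : #|F| = m.*2.+1.
Hypothesis q_ge : (89 <= #|F|)%N.
Hypothesis nz2 : (2 : F) != 0.
Hypothesis nz3 : (3 : F) != 0.
Implicit Types x : nat -> F.

Lemma nz4 : (4 : F) != 0.
Proof. have -> : (4 : F) = 2 * 2 by ring. exact: mulf_neq0. Qed.

(* Here the discriminant of covered_tangents is 3/16 (a^2-d)^4 (a^2-2d). *)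
Lemma covered_cube_pencil (d : F) x : d != 0 ->
  x 0%N = 3 -> x 1%N = 0 -> x 2 = - d -> x 3 = 0 -> x 4 = 3 * d ^+ 2 -> covered x.
Proof.
move=> nzd x0 x1 x2 x3 x4.
pose P : {poly F} := ('X^2 - d%:P) ^+ 4 * ('X^2 - (2 * d)%:P).
have sP : (size P <= 11)%N.
  rewrite (leq_trans (size_polyMleq _ _)) // size_XnsubC // addn3 /=.
  by have := size_poly_exp_leq ('X^2 - d%:P) 4; rewrite size_XnsubC.
have [s y nzy Py | cov | nsq] := @nonsquare_or F (3 *: P) (covered x).
  have nz : y / 4 != 0 by rewrite mulf_neq0 ?invr_neq0 ?nz4.
  apply: (covered_tangents nz2 nz3 (a := s) nz).
  have -> : (y / 4) ^+ 2 = 3 * ((s ^+ 2 - d) ^+ 4 * (s ^+ 2 - 2 * d)) / 16.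
    rewrite exprMn -Py /P hornerZ hornerM horner_exp !hornerD !hornerN !hornerC !hornerXn.
    by rewrite exprVn; congr (_ / _); ring.
  rewrite x0 x1 x2 x3 x4 /cubic_disc.
  have nz16 : 16 != 0 :> F.
    have -> : 16 = 4 * 4 :> F by ring.
    by rewrite mulf_neq0 ?nz4.
  by field; rewrite nz16 nz2 nz3 nz4.
  exact: cov.
have [|c [G PG]] := nonsquare_values q_odd q_ge nz2 nz3 _ nsq.
  by rewrite size_scale.
have PE : 'X^10 + 0%:P * 'X^9 + (- (6 * d))%:P * 'X^8 + 0%:P * 'X^7
   + (14 * d ^+ 2)%:P * 'X^6 + 0%:P * 'X^5 + (- (16 * d ^+ 3))%:P * 'X^4
   + 0%:P * 'X^3 + (9 * d ^+ 4)%:P * 'X^2 + 0%:P * 'X + (- (2 * d ^+ 5))%:P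
   = (3^-1 * c) *: G ^+ 2.
  rewrite -scalerA -PG scalerA mulVf // scale1r /P.
  rewrite !(rmorphN, rmorphM, rmorphXn, rmorph_nat, rmorph0) /=.
  by move: (d%:P) => D; ring.
have [h0 [h1 [h2 [h3 [h4 [[e9 e8 e7 e6 e5] [e4 _ _ _]]]]]]] := monic_decic_square PE.
have h4_0 : h4 = 0 by apply: (mulfI nz2); rewrite -e9 mulr0.
have h3E : h3 = - (3 * d).
  by apply: (mulfI nz2); move: e8; rewrite h4_0 expr0n addr0 => <-; ring.
have h2_0 : h2 = 0 by apply: (mulfI nz2); move: e7; rewrite h4_0 !mulr0 addr0.
have h0_0 : h0 = 0.
  by apply: (mulfI nz2); move: e5; rewrite h4_0 h2_0 !(mulr0, mul0r, addr0).
have h1E : 2 * h1 = 5 * d ^+ 2.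
  have -> : 2 * h1 = 14 * d ^+ 2 - h3 ^+ 2 by rewrite e6 h4_0; ring.
  by rewrite h3E; ring.
(* In the square of the quintic, T^4 has the coefficient 2 h1 h3 = - 15 d^3 in place of - 16 d^3. *)
have d3 : 16 * d ^+ 3 = 15 * d ^+ 3.
  by apply: oppr_inj; rewrite e4 h4_0 h2_0 h1E h3E; ring.
have : d ^+ 3 == 0.
  have -> : d ^+ 3 = 16 * d ^+ 3 - 15 * d ^+ 3 by ring.
  by rewrite d3 subrr.
by rewrite expf_eq0 (negPf nzd).
Qed.

(* x is a combination of the evaluations at the two square roots of d. The
   discriminant of covered_tangents has degree 10 and leading coefficient 1/432
   and is not a constant times a square. *)
Lemma covered_imaginary_secant (d v : F) x : d != 0 -> v ^+ 2 != d ->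
  x 0%N = 1 -> x 1%N = v -> x 2 = d -> x 3 = d * v -> x 4 = d ^+ 2 -> covered x.
Proof.
move=> nzd nzvd x0 x1 x2 x3 x4; have nz4 := nz4.
have nz48 : 48 != 0 :> F.
  have -> : 48 = 4 * 4 * 3 :> F by ring.
  by rewrite !mulf_neq0 ?nz4.
(* The factors 12, 6, 4 and 3 clear the denominators 1, 2, 3 and 4 in [covered_tangents], which
   multiplies the discriminant by the square 12^4 = 144^2. *)
pose P : {poly F} := cubic_disc (12 * (v%:P - 'X)) (6 * (d%:P - 'X^2))
  (4 * ((d * v)%:P - 'X^3)) (3 * ((d ^+ 2)%:P - 'X^4)).
have PE : P = 48 * ('X^10 + (- (10 * v))%:P * 'X^9 + (27 * v ^+ 2 + 18 * d)%:P * 'X^8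
  + (- (120 * v * d))%:P * 'X^7 + (84 * v ^+ 2 * d + 126 * d ^+ 2)%:P * 'X^6
  + (- (252 * v * d ^+ 2))%:P * 'X^5 + (210 * v ^+ 2 * d ^+ 2)%:P * 'X^4
  + (72 * v * d ^+ 3 - 192 * v ^+ 3 * d ^+ 2)%:P * 'X^3
  + (180 * v ^+ 2 * d ^+ 3 - 135 * d ^+ 4)%:P * 'X^2
  + (54 * v * d ^+ 4 - 64 * v ^+ 3 * d ^+ 3)%:P * 'X
  + (64 * v ^+ 4 * d ^+ 3 - 117 * v ^+ 2 * d ^+ 4 + 54 * d ^+ 5)%:P).
  exact: (imaginary_secant_disc polyC 'X d v).
have sP : (size P <= 11)%N.
  rewrite PE -(polyC_natr _ 48) size_Cmul //; apply/leq_sizeP => k k11.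
  rewrite !(coefD, coefCM, coefC, coefXn, coefX).
  by move: k k11 => [|[|[|[|[|[|[|[|[|[|[|k]]]]]]]]]]] //= _; rewrite !(mulr0, addr0).
have [s y nzy Py | cov | nsq] := @nonsquare_or F P (covered x).
  have nz12 : 12 != 0 :> F by have -> : 12 = 4 * 3 :> F; [ring | rewrite mulf_neq0 ?nz4].
  have nz144 : 144 != 0 :> F by have -> : 144 = 12 * 12 :> F; [ring | rewrite mulf_neq0].
  have nz : y / 144 != 0 by rewrite mulf_neq0 ?invr_neq0.
  apply: (covered_tangents nz2 nz3 (a := s) nz).
  have -> : (y / 144) ^+ 2 = cubic_disc (12 * (v - s)) (6 * (d - s ^+ 2))
      (4 * (d * v - s ^+ 3)) (3 * (d ^+ 2 - s ^+ 4)) / 144 ^+ 2.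
    rewrite exprMn -Py exprVn /P -[_.[s]]/(horner_eval s _) rmorph_cubic_disc.
    rewrite /= /horner_eval -(polyC_natr _ 12) -(polyC_natr _ 6) -(polyC_natr _ 4).
    by rewrite -(polyC_natr _ 3) !(hornerM, hornerD, hornerN, hornerC, hornerX, hornerXn).
  rewrite x0 x1 x2 x3 x4 !mulr1.
  have -> : 6 * (d - s ^+ 2) = 12 * ((d - s ^+ 2) / 2) by field.
  have -> : 4 * (d * v - s ^+ 3) = 12 * ((d * v - s ^+ 3) / 3) by field.
  have -> : 3 * (d ^+ 2 - s ^+ 4) = 12 * ((d ^+ 2 - s ^+ 4) / 4) by field.
  rewrite cubic_discZ; have -> : 144 ^+ 2 = 12 ^+ 4 :> F by ring.
  by rewrite [_ ^+ 4 * _]mulrC mulfK // expf_neq0.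
  exact: cov.
have [c [G PG]] := nonsquare_values q_odd q_ge nz2 nz3 sP nsq.
have {}PE : 'X^10 + (- (10 * v))%:P * 'X^9 + (27 * v ^+ 2 + 18 * d)%:P * 'X^8
  + (- (120 * v * d))%:P * 'X^7 + (84 * v ^+ 2 * d + 126 * d ^+ 2)%:P * 'X^6
  + (- (252 * v * d ^+ 2))%:P * 'X^5 + (210 * v ^+ 2 * d ^+ 2)%:P * 'X^4
  + (72 * v * d ^+ 3 - 192 * v ^+ 3 * d ^+ 2)%:P * 'X^3
  + (180 * v ^+ 2 * d ^+ 3 - 135 * d ^+ 4)%:P * 'X^2
  + (54 * v * d ^+ 4 - 64 * v ^+ 3 * d ^+ 3)%:P * 'X
  + (64 * v ^+ 4 * d ^+ 3 - 117 * v ^+ 2 * d ^+ 4 + 54 * d ^+ 5)%:P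
  = (48^-1 * c) *: G ^+ 2.
  by rewrite -scalerA -PG PE -(polyC_natr _ 48) (mul_polyC 48) scalerA mulVf // scale1r.
have [h0 [h1 [h2 [h3 [h4 [[e9 e8 e7 e6 e5] [e4 e3 e2 e0]]]]]]] := monic_decic_square PE.
case: (imaginary_secant_not_square nz2 nz3 nzd nzvd e9 e8 e7 e6 e5 e4 e3 e2 e0).
Qed.
End SpecialPoints.

(** * Reduction of all points to the special families *)

Section AllPoints.
Variable F : finFieldType.
Variable m : nat.
Hypothesis q_odd : #|F| = m.*2.+1.
Hypothesis q_ge : (89 <= #|F|)%N.
Hypothesis nz2 : (2 : F) != 0.
Hypothesis nz3 : (3 : F) != 0.
Implicit Types x : nat -> F.

Let nz4 : (4 : F) != 0. Proof. exact: nz4. Qed.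

(** Such [x] form the line through the evaluations at the square roots of [d]: a secant, the tangent
    line at 0 if d = 0, or an imaginary secant if [d] is a nonsquare. *)
Lemma covered_secant_line (d : F) x :
  (forall n, (n < 3)%N -> x n.+2 = d * x n) -> covered x.
Proof.
move=> rec; have x2 := rec 0%N isT; have x3 := rec 1%N isT.
have x4 : x 4 = d ^+ 2 * x 0%N by rewrite (rec 2%N isT) x2; ring.
have [/existsP[z /eqP dE] | ] := boolP [exists z, d == z ^+ 2]; last first.
  rewrite negb_exists => /forallP nsq.
  have nzd : d != 0 by apply: contraNneq (nsq 0) => ->; rewrite expr0n.
  (* If x_0 = 0, normalising to x_0 = 1 is impossible, but multiples of (0, 1, 0, d, 0) are
     combinations of the tangent points at 0, 1 and -1. *)
  have [x0 | nzx0] := eqVneq (x 0%N) 0.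
    pose b := d * x 1%N / 6.
    have nz6 : (6 : F) != 0 by have -> : 6 = 2 * 3 :> F; [ring | rewrite mulf_neq0].
    apply: (@coveredI _ (Some (true, 0)) (Some (true, 1)) (Some (true, -1))
      (x 1%N - 2 * b) b b); rewrite /= ?x4 ?x3 ?x2 ?x0 /b; by field.
  apply: (@covered_scale _ (x 0%N)^-1); first by rewrite invr_eq0.
  apply: (@covered_imaginary_secant _ m q_odd q_ge nz2 nz3 d (x 1%N / x 0%N)) => //.
  - by rewrite eq_sym nsq.
  - by rewrite mulVf.
  - by rewrite mulrC.
  - by rewrite x2; field.
  - by rewrite x3; field.
  - by rewrite x4; field.
have [z0 | nzz] := eqVneq z 0.
  apply: (@coveredI _ (Some (false, 0)) (Some (true, 0)) None (x 0%N) (x 1%N) 0);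
    rewrite /= ?x4 ?x3 ?x2 ?dE ?z0; ring.
apply: (@coveredI _ (Some (false, z)) (Some (false, - z)) None
  ((x 0%N + x 1%N / z) / 2) ((x 0%N - x 1%N / z) / 2) 0);
  rewrite /= ?x4 ?x3 ?x2 ?dE; field; by rewrite ?nzz ?nz2.
Qed.

(** If [q2] is nonzero, a translation completes the square of q0 + q1 T + q2 T^2. Otherwise one or
    both roots of this apolar quadratic are at infinity. *)
Lemma covered_apolar_quadratic (q0 q1 q2 : F) x :
  [|| q0 != 0, q1 != 0 | q2 != 0] ->
  (forall n, (n < 3)%N -> q0 * x n + q1 * x n.+1 + q2 * x n.+2 = 0) -> covered x.
Proof.
move=> nzq rec; have E0 := rec 0%N isT; have E1 := rec 1%N isT; have E2 := rec 2%N isT.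
have [q20 | nzq2] := eqVneq q2 0; last first.
  pose e := q1 / (2 * q2).
  apply: (covered_translate (e := e)); apply: (@covered_secant_line (e ^+ 2 - q0 / q2)).
  have xE n : (n < 3)%N -> x n.+2 = - (q0 / q2 * x n + 2 * e * x n.+1).
    move=> /rec; rewrite /e => En; apply: (mulfI nzq2); apply: subr0_eq.
    by rewrite -En; field; rewrite nz2 nzq2.
  case=> [|[|[|n]]] //= _; rewrite ?(xE 2%N isT) ?(xE 1%N isT) ?(xE 0%N isT); ring.
have [q10 | nzq1] := eqVneq q1 0; last first.
  pose t := - (q0 / q1).
  have xE n : (n < 3)%N -> x n.+1 = t * x n.
    move=> /rec; rewrite q20 mul0r addr0 => En; apply: (mulfI nzq1); apply: subr0_eq.
    by rewrite -En /t; field.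
  apply: (@coveredI _ (Some (false, t)) None None (x 0%N) (x 4 - t ^+ 4 * x 0%N) 0);
    rewrite /= ?(xE 2%N isT) ?(xE 1%N isT) ?(xE 0%N isT); ring.
have nzq0 : q0 != 0 by move: nzq; rewrite q10 q20 eqxx !orbF.
have x0 n : (n < 3)%N -> x n = 0.
  by move=> /rec; rewrite q10 q20 !mul0r !addr0 => /eqP; rewrite mulf_eq0 (negPf nzq0) => /eqP.
have x012 := (x0 0%N isT, x0 1%N isT, x0 2%N isT).
have [x3 | nzx3] := eqVneq (x 3) 0.
  apply: (@coveredI _ None None None (x 4) 0 0); rewrite /= ?x012 ?x3; ring.
(* This removes the last coordinate, leaving a multiple of (0, 0, 0, 1, 0). *)
apply: (covered_translate (e := - (x 4 / (4 * x 3)))).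
have nz6 : (6 : F) != 0 by have -> : 6 = 2 * 3 :> F; [ring | rewrite mulf_neq0].
apply: (@coveredI _ (Some (true, 0)) (Some (true, 1)) (Some (true, -1))
  (- (x 3 / 3)) (x 3 / 6) (x 3 / 6)); rewrite /= ?x012; field; by rewrite ?(nz6, nz3, nz4, nzx3).
Qed.

(** The catalecticant, the determinant of the 3 by 3 Hankel matrix. *)
Definition hankel x :=
  x 0%N * x 2 * x 4 + 2 * x 1%N * x 2 * x 3 - x 2 ^+ 3 - x 0%N * x 3 ^+ 2
    - x 1%N ^+ 2 * x 4.

(** A kernel vector of the Hankel matrix is an apolar quadratic. *)
Lemma covered_hankel0 x : hankel x = 0 -> covered x.
Proof.
move=> J0; pose A : 'M[F]_3 := \matrix_(i, j) x (i + j)%N.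
have : \det A == 0.
  rewrite (expand_det_row _ 0) !big_ord_recr big_ord0 /= /cofactor.
  rewrite !(expand_det_row _ 0) !big_ord_recr !big_ord0 /= /cofactor !det_mx11 !mxE /=.
  by apply/eqP; rewrite -[RHS]J0 /hankel /bump /= !(addn0, add0n) /=; ring.
case/det0P => v nzv vA.
apply: (@covered_apolar_quadratic (v 0 0) (v 0 1) (v 0 2)).
  apply: contraNT nzv; rewrite !negb_or !negbK => /and3P[/eqP v0 /eqP v1 /eqP v2].
  apply/eqP/rowP => i; rewrite mxE.
  case: i => [[|[|[|i]]] i3] //;
    [rewrite -[RHS]v0 | rewrite -[RHS]v1 | rewrite -[RHS]v2];
    by congr (v _ _); apply: val_inj.
move=> n n3; have := congr1 (fun u : 'rV_3 => u 0 (Ordinal n3)) vA.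
rewrite !mxE !big_ord_recr big_ord0 /= !mxE /= add0r => <-.
by congr (_ + _ + _); congr (v _ _ * x _); rewrite ?addnC //; apply: val_inj.
Qed.

(* The covariants of the binary quartic x: [quartic_inv] is its invariant of
   degree 2 and [secant_coef x k] the coefficient of s ^ k in the discriminant
   of [covered_secants]. *)
Definition quartic_inv x := x 0%N * x 4 - 4 * x 1%N * x 3 + 3 * x 2 ^+ 2.

Definition secant_coef x (k : nat) : F :=
  match k with
  | 0 => quartic_inv x * (x 2 * x 4 - x 3 ^+ 2) - hankel x * x 4
  | 1 => 4 * hankel x * x 3 - 2 * quartic_inv x * (x 1%N * x 4 - x 2 * x 3)
  | 2 => quartic_inv x * (x 0%N * x 4 + 2 * x 1%N * x 3 - 3 * x 2 ^+ 2)
         - 6 * hankel x * x 2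
  | 3 => 4 * hankel x * x 1%N - 2 * quartic_inv x * (x 0%N * x 3 - x 1%N * x 2)
  | 4 => quartic_inv x * (x 0%N * x 2 - x 1%N ^+ 2) - hankel x * x 0%N
  | _ => 0
  end.

Lemma secant_coefE x s : (\poly_(k < 5) secant_coef x k).[s] =
  cubic_disc (x 1%N - s * x 0%N) (x 2 - s * x 1%N) (x 3 - s * x 2) (x 4 - s * x 3).
Proof.
rewrite horner_poly !big_ord_recr big_ord0 /= /cubic_disc /quartic_inv /hankel; ring.
Qed.

Lemma secant_coef_square x : covered x \/ exists c g0 g1 g2 : F,
  [/\ secant_coef x 0 = c * g0 ^+ 2, secant_coef x 1 = 2 * c * g0 * g1,
      secant_coef x 2 = c * (2 * g0 * g2 + g1 ^+ 2),
      secant_coef x 3 = 2 * c * g1 * g2 & secant_coef x 4 = c * g2 ^+ 2].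
Proof.
set P := \poly_(k < 5) secant_coef x k.
have [s y nzy | cov | nsq] := @nonsquare_or F P (covered x).
- by rewrite secant_coefE => yE; apply: (covered_secants nz2 nzy yE).
- by left.
have sP : (size P <= 5)%N by apply: size_poly.
have Pk k : (k < 5)%N -> P`_k = secant_coef x k by move=> k5; rewrite coef_poly k5.
right; rewrite -!Pk //; have [P0 | nzP] := eqVneq P 0.
  by exists 0, 0, 0, 0; rewrite P0 !coef0; split; ring.
have [c [G PE]] := nonsquare_values q_odd q_ge nz2 nz3 (leq_trans sP (isT : (5 <= 11)%N)) nsq.
have [nzc nzG] : c != 0 /\ G != 0.
  by apply/andP; move: nzP; rewrite PE scaler_eq0 expf_eq0 negb_or.
have sG : (size G <= 3)%N.
  move: sP (nzG); rewrite PE size_scale // expr2 size_mul // -size_poly_gt0.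
  by move: (size G) => n; lia.
have Gz := (size_coef_eq0 sG (isT : (3 <= 3)%N), size_coef_eq0 sG (isT : (3 <= 4)%N)).
exists c, G`_0, G`_1, G`_2; rewrite PE !coefZ expr2 !coefM.
by rewrite !big_ord_recr !big_ord0 /= !Gz; split; ring.
Qed.

Lemma hankel_translate e x : hankel (translate e x) = hankel x.
Proof. rewrite /hankel /=; ring. Qed.

Lemma quartic_inv_translate e x : quartic_inv (translate e x) = quartic_inv x.
Proof. rewrite /quartic_inv /=; ring. Qed.

(** The discriminant polynomial of the translate at s is that of [x] at s - e. *)
Lemma secant_coef_translate e x (d := secant_coef x) (d' := secant_coef (translate e x)) :
  [/\ d' 0%N = d 0%N - e * d 1%N + e ^+ 2 * d 2 - e ^+ 3 * d 3 + e ^+ 4 * d 4,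
      d' 1%N = d 1%N - 2 * e * d 2 + 3 * e ^+ 2 * d 3 - 4 * e ^+ 3 * d 4,
      d' 2 = d 2 - 3 * e * d 3 + 6 * e ^+ 2 * d 4,
      d' 3 = d 3 - 4 * e * d 4 & d' 4 = d 4].
Proof.
rewrite /d' /d /secant_coef hankel_translate quartic_inv_translate /=.
by split; rewrite /hankel /quartic_inv; ring.
Qed.

(** Let I be the quadratic invariant and J the catalecticant; I = 0 is immediate. Otherwise put l =
    2 J / I and a = x_2 + l, so that x_0 x_3 = a x_1 and x_1 x_4 = a x_3. Unless x_1 = x_3 = 0, this
    forces x_0 x_4 = a^2, and then l^3 = l I - 2 J = 0, although l is nonzero. *)
Lemma secant_coef_odd0 x : hankel x != 0 ->
  secant_coef x 1 = 0 -> secant_coef x 3 = 0 -> x 1%N = 0 /\ x 3 = 0.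
Proof.
move=> nzJ /= e1 e3; have [I0 | nzI] := eqVneq (quartic_inv x) 0.
  have nz4J : 4 * hankel x != 0 by rewrite mulf_neq0.
  by split; apply: (mulfI nz4J); rewrite mulr0; [move: e3 | move: e1];
    rewrite I0 mulr0 mul0r subr0.
pose l := 2 * hankel x / quartic_inv x.
have nzl : l != 0 by rewrite !mulf_neq0 ?invr_eq0.
have lE : l * quartic_inv x = 2 * hankel x by rewrite divfK.
pose a := x 2 + l.
have nz2I : 2 * quartic_inv x != 0 by rewrite mulf_neq0.
have e03 : x 0%N * x 3 = a * x 1%N.
  apply/esym/subr0_eq; apply: (mulfI nz2I); rewrite mulr0.
  transitivity (2 * (2 * hankel x) * x 1%N
    - 2 * quartic_inv x * (x 0%N * x 3 - x 1%N * x 2)); last by rewrite -e3; ring.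
  by rewrite -lE /a; ring.
have e14 : x 1%N * x 4 = a * x 3.
  apply/esym/subr0_eq; apply: (mulfI nz2I); rewrite mulr0.
  transitivity (2 * (2 * hankel x) * x 3
    - 2 * quartic_inv x * (x 1%N * x 4 - x 2 * x 3)); last by rewrite -e1; ring.
  by rewrite -lE /a; ring.
have [|nz13] := boolP ((x 1%N == 0) && (x 3 == 0)); first by case/andP => /eqP -> /eqP.
have e04 : x 0%N * x 4 = a ^+ 2.
  move: nz13; rewrite negb_and => /orP[nz1 | nz3'].
    by apply: (mulIf nz1); rewrite -mulrA [x 4 * _]mulrC e14 mulrCA e03; ring.
  by apply: (mulIf nz3'); rewrite mulrAC e03 -mulrA e14; ring.
case/eqP: (expf_neq0 3 nzl).
transitivity (l * quartic_inv x - 2 * hankel x); last by rewrite lE subrr.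
have -> : hankel x = x 2 * (x 0%N * x 4) + 2 * x 1%N * x 2 * x 3 - x 2 ^+ 3
   - (x 0%N * x 3) * x 3 - (x 1%N * x 4) * x 1%N by rewrite /hankel; ring.
rewrite /quartic_inv e04 e03 e14 /a; ring.
Qed.

(** Only x_0, r = x_2 and x_4 are left. With p = x_0 x_4, the first alternative says (p - r^2)^3 (p
    - 9 r^2) = 0, where r (p - r^2) is the catalecticant; so p = 9 r^2, the family of
    [covered_cube_pencil]. The second leaves (0 : 0 : 1 : 0 : 0). *)
Lemma covered_even_quartic x : hankel x != 0 ->
  secant_coef x 1 = 0 -> secant_coef x 3 = 0 ->
  secant_coef x 2 ^+ 2 = 4 * secant_coef x 0 * secant_coef x 4 \/
  secant_coef x 0 = 0 /\ secant_coef x 4 = 0 -> covered x.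
Proof.
move=> nzJ e1 e3; have [x1 x3] := secant_coef_odd0 nzJ e1 e3.
move: nzJ; rewrite /secant_coef /quartic_inv /hankel x1 x3.
set p := x 0%N * x 4; set r := x 2 => nzJ.
have {nzJ} [nzr nzpr] : r != 0 /\ p - r ^+ 2 != 0.
  apply/andP; rewrite -negb_or -mulf_eq0; apply: contraNneq nzJ => J0.
  by apply/eqP; rewrite -[RHS]J0 /p; ring.
case=> [/eqP | [d0 d4]]; last first.
  have nz4r : 4 * r ^+ 3 != 0 by rewrite mulf_neq0 ?expf_neq0.
  have x0 : x 0%N = 0 by apply: (mulfI nz4r); rewrite mulr0 -d4 /p; ring.
  have x4 : x 4 = 0 by apply: (mulfI nz4r); rewrite mulr0 -d0 /p; ring.
  apply: (@coveredI _ (Some (true, 1)) (Some (true, -1)) None (r / 4) (- (r / 4)) (- (2 * r)));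
    rewrite /= ?x0 ?x1 ?x3 ?x4 /r; by field.
rewrite -subr_eq0 => /eqP sq.
have : (p - r ^+ 2) ^+ 3 * (p - 9 * r ^+ 2) == 0 by apply/eqP; rewrite -[RHS]sq /p; ring.
rewrite mulf_eq0 (negPf (expf_neq0 3 nzpr)) subr_eq0 /= => /eqP pE.
have nzx0 : x 0%N != 0.
  apply: contraTneq (expf_neq0 2 (mulf_neq0 nz3 nzr)) => x0; rewrite negbK.
  by apply/eqP; transitivity p; [rewrite pE; ring | rewrite /p x0 mul0r].
apply: (@covered_scale _ (3 / x 0%N)); first by rewrite mulf_neq0 ?invr_eq0.
apply: (@covered_cube_pencil _ m q_odd q_ge nz2 nz3 (- (3 * r / x 0%N))).
- by rewrite oppr_eq0 !mulf_neq0 ?invr_eq0.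
- by rewrite divfK.
- by rewrite x1 mulr0.
- by rewrite -/r; field.
- by rewrite x3 mulr0.
- have -> : x 4 = 9 * r ^+ 2 / x 0%N by rewrite -pE /p; field.
  by field.
Qed.

Theorem covered_all x : covered x.
Proof.
have [J0 | nzJ] := eqVneq (hankel x) 0; first exact: covered_hankel0.
have [// | [c [g0 [g1 [g2 [d0 d1 d2 d3 d4]]]]]] := secant_coef_square x.
suff [e [e1 e3 e024]] : exists e,
    [/\ secant_coef (translate e x) 1 = 0, secant_coef (translate e x) 3 = 0 &
     secant_coef (translate e x) 2 ^+ 2
       = 4 * secant_coef (translate e x) 0 * secant_coef (translate e x) 4 \/
     secant_coef (translate e x) 0 = 0 /\ secant_coef (translate e x) 4 = 0].
  apply: (covered_translate (e := e)).
  by apply: covered_even_quartic; rewrite ?hankel_translate.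
(* The translation removes the linear term of g0 + g1 s + g2 s^2 or, if the degree is 1, moves the
   root to 0. Either way the square becomes even in s. *)
have [g20 | nzg2] := eqVneq g2 0; last first.
  exists (g1 / (2 * g2)); have [-> -> -> -> ->] := secant_coef_translate (g1 / (2 * g2)) x.
  have g1E : g1 = 2 * (g1 / (2 * g2)) * g2 by field; rewrite nz2 nzg2.
  rewrite d0 d1 d2 d3 d4; move: (_ / _) g1E => e ->.
  by split; [ring | ring | left; ring].
have [g10 | nzg1] := eqVneq g1 0.
  exists 0; have [-> -> -> -> ->] := secant_coef_translate 0 x.
  by rewrite d0 d1 d2 d3 d4 g20 g10; split; [ring | ring | left; ring].
exists (g0 / g1); have [-> -> -> -> ->] := secant_coef_translate (g0 / g1) x.
rewrite d0 d1 d2 d3 d4 g20.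
by split; [field | ring | right; split; [field | ring]].
Qed.

End AllPoints.

(** * Independence of four points of the track *)

Section TrackIndependence.
Variable F : finFieldType.
Hypothesis nz2 : (2 : F) != 0.
Hypothesis nz3 : (3 : F) != 0.

Let nz6 : (6 : F) != 0.
Proof. have -> : 6 = 2 * 3 :> F by ring. exact: mulf_neq0. Qed.

Let nz12 : (12 : F) != 0.
Proof. have -> : 12 = 2 * 6 :> F by ring. exact: mulf_neq0. Qed.

(** A dependence is applied to the test polynomial with coefficients [f0] to [f4], chosen to be
    killed by all points but one, on which it takes the value [v]; so the coefficient [k] of that
    point vanishes. *)
Lemma relation_test (r : nat -> F) (k v f0 f1 f2 f3 f4 : F) :
  (forall n, (n < 5)%N -> r n = 0) -> v != 0 ->
  k * v = f0 * r 0%N + f1 * r 1%N + f2 * r 2 + f3 * r 3 + f4 * r 4 -> k = 0.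
Proof.
move=> r0 nzv; rewrite !r0 // !mulr0 !addr0 => /eqP.
by rewrite mulf_eq0 (negPf nzv) orbF => /eqP.
Qed.

Definition dependence (i j k l : option (bool * F)) (c1 c2 c3 c4 : F) (n : nat) :=
  c1 * track_coord i n + c2 * track_coord j n + c3 * track_coord k n
  + c4 * track_coord l n.

Local Notation pt t := (Some (false, t)).
Local Notation tg t := (Some (true, t)).
Local Notation independent i j k l := (forall c1 c2 c3 c4 : F,
  (forall n, (n < 5)%N -> dependence i j k l c1 c2 c3 c4 n = 0) ->
  [/\ c1 = 0, c2 = 0, c3 = 0 & c4 = 0]).

Local Ltac test v f0 f1 f2 f3 f4 r0 :=
  apply: (@relation_test _ _ v f0 f1 f2 f3 f4 r0);
  [first [by [] | do ?apply: mulf_neq0; by rewrite ?subr_eq0 ?oner_neq0]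
  | rewrite /dependence /=; ring].

Lemma independent_cccc (a b c d : F) : uniq [:: a; b; c; d] ->
  independent (pt a) (pt b) (pt c) (pt d).
Proof.
have first a' b' c' d' c1 c2 c3 c4 : a' != b' -> a' != c' -> a' != d' ->
    (forall n, (n < 5)%N -> dependence (pt a') (pt b') (pt c') (pt d') c1 c2 c3 c4 n = 0) ->
    c1 = 0.
  move=> ab ac ad r0.
  test ((a' - b') * (a' - c') * (a' - d')) (- (b' * c' * d'))
    (b' * c' + b' * d' + c' * d') (- (b' + c' + d')) (1 : F) (0 : F) r0.
rewrite /= !inE !negb_or => /and4P[/and3P[ab ac ad] /andP[bc bd] cd _] c1 c2 c3 c4 r0.
split; [apply: (first a b c d c1 c2 c3 c4) | apply: (first b a c d c2 c1 c3 c4)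
  | apply: (first c a b d c3 c1 c2 c4) | apply: (first d a b c c4 c1 c2 c3)];
  rewrite // 1?eq_sym // => n n5; rewrite -[RHS](r0 n n5) /dependence; ring.
Qed.

Lemma independent_ccct (a b c d : F) : uniq [:: a; b; c] ->
  independent (pt a) (pt b) (pt c) (tg d).
Proof.
rewrite /= !inE negb_or => /and3P[/andP[ab ac] bc _] c1 c2 c3 c4 r0.
have ba : b != a by rewrite eq_sym.
have ca : c != a by rewrite eq_sym.
have cb : c != b by rewrite eq_sym.
have c40 : c4 = 0.
  (* With g = (T - a) (T - b) (T - c), the test polynomial (T - d) g has derivative g (d) at d. If
     this is 0, then d is a simple root of g, and g itself is the test. *)
  have [gd0 | gd_neq0] := eqVneq ((d - a) * (d - b) * (d - c)) 0; last first.
    test ((d - a) * (d - b) * (d - c)) (d * (a * b * c))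
     (- (a * b * c + d * (a * b + a * c + b * c)))
     (a * b + a * c + b * c + d * (a + b + c)) (- (a + b + c + d)) (1 : F) r0.
  have gd'_neq0 : (d - a) * (d - b) + (d - a) * (d - c) + (d - b) * (d - c) != 0.
    by move/eqP: gd0; rewrite !mulf_eq0 !subr_eq0 => /orP[/orP[]|] /eqP ->;
      rewrite subrr !(mul0r, mulr0, add0r, addr0) mulf_neq0 ?subr_eq0.
  test ((d - a) * (d - b) + (d - a) * (d - c) + (d - b) * (d - c)) (- (a * b * c))
    (a * b + a * c + b * c) (- (a + b + c)) (1 : F) (0 : F) r0.
move: r0; rewrite c40 => r0.
split=> //; [test ((a - b) * (a - c)) (b * c) (- (b + c)) (1 : F) (0 : F) (0 : F) r0
  | test ((b - a) * (b - c)) (a * c) (- (a + c)) (1 : F) (0 : F) (0 : F) r0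
  | test ((c - a) * (c - b)) (a * b) (- (a + b)) (1 : F) (0 : F) (0 : F) r0].
Qed.

(* The difference of the two tests gives c + d = a + b, whence the discriminant
   of (T - c) (T - d) satisfies 3 (c - d)^2 = (a - b)^2. *)
Lemma independent_cctt (a b c d : F) : (forall y : F, y ^+ 2 != 3) ->
  a != b -> c != d -> independent (pt a) (pt b) (tg c) (tg d).
Proof.
move=> nsq3 ab cd c1 c2 c3 c4 r0.
have nzba : b - a != 0 by rewrite subr_eq0 eq_sym.
have nzcd : c - d != 0 by rewrite subr_eq0.
have dc : d != c by rewrite eq_sym.
(* These are primitives of 6 (T - c) (T - d) and 12 T (T - c) (T - d), so both tangent points kill
   them. *)
pose f t := 2 * t ^+ 3 - 3 * (c + d) * t ^+ 2 + 6 * c * d * t.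
pose g t := 3 * t ^+ 4 - 4 * (c + d) * t ^+ 3 + 6 * c * d * t ^+ 2.
have c20 : c2 = 0.
  have [fab | nzfab] := eqVneq (f b - f a) 0; last first.
    apply: (relation_test (f0 := - f a) (f1 := 6 * c * d) (f2 := - (3 * (c + d)))
      (f3 := 2) (f4 := 0) r0 nzfab); rewrite /dependence /f /=; ring.
  have [gab | nzgab] := eqVneq (g b - g a) 0; last first.
    apply: (relation_test (f0 := - g a) (f1 := 0) (f2 := 6 * c * d)
      (f3 := - (4 * (c + d))) (f4 := 3) r0 nzgab); rewrite /dependence /g /=; ring.
  have cdE : c + d = a + b.
    apply: subr0_eq; apply: (mulfI (expf_neq0 3 nzba)); rewrite mulr0.
    transitivity ((a + b) * (f b - f a) - (g b - g a)).
      by rewrite /f /g; ring.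
    by rewrite fab gab mulr0 subrr.
  have sq3 : (b - a) ^+ 2 = 3 * (c - d) ^+ 2.
    apply: (mulfI nzba); apply: subr0_eq; transitivity (2 * (f b - f a)).
      by rewrite /f (_ : d = a + b - c); [ring | rewrite -cdE; ring].
    by rewrite fab mulr0.
  case/eqP: (nsq3 ((b - a) / (c - d))).
  by rewrite exprMn exprVn sq3 mulfK // expf_neq0.
move: r0; rewrite c20 => r0.
have c10 : c1 = 0.
  test (1 : F) (1 : F) (0 : F) (0 : F) (0 : F) (0 : F) r0.
move: r0; rewrite c10 => r0.
split=> //; [test (2 * (c - d)) (0 : F) (- (2 * d)) (1 : F) (0 : F) (0 : F) r0
  | test (2 * (d - c)) (0 : F) (- (2 * c)) (1 : F) (0 : F) (0 : F) r0].
Qed.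

Lemma independent_cttt (a b c d : F) : uniq [:: b; c; d] ->
  independent (pt a) (tg b) (tg c) (tg d).
Proof.
rewrite /= !inE negb_or => /and3P[/andP[bc bd] cd _] c1 c2 c3 c4 r0.
have cb : c != b by rewrite eq_sym.
have db : d != b by rewrite eq_sym.
have dc : d != c by rewrite eq_sym.
have c10 : c1 = 0.
  test (1 : F) (1 : F) (0 : F) (0 : F) (0 : F) (0 : F) r0.
move: r0; rewrite c10 => r0.
split=> //; [test (6 * ((b - c) * (b - d))) (0 : F) (6 * c * d) (- (3 * (c + d))) (2 : F) (0 : F) r0
  | test (6 * ((c - b) * (c - d))) (0 : F) (6 * b * d) (- (3 * (b + d))) (2 : F) (0 : F) r0
  | test (6 * ((d - b) * (d - c))) (0 : F) (6 * b * c) (- (3 * (b + c))) (2 : F) (0 : F) r0].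
Qed.

Lemma independent_tttt (a b c d : F) : uniq [:: a; b; c; d] ->
  independent (tg a) (tg b) (tg c) (tg d).
Proof.
have first a' b' c' d' c1 c2 c3 c4 : a' != b' -> a' != c' -> a' != d' ->
    (forall n, (n < 5)%N -> dependence (tg a') (tg b') (tg c') (tg d') c1 c2 c3 c4 n = 0) ->
    c1 = 0.
  move=> ab ac ad r0.
  (* The test polynomial is a primitive of 12 (T - b') (T - c') (T - d'). *)
  test (12 * ((a' - b') * (a' - c') * (a' - d'))) (0 : F) (- (12 * b' * c' * d'))
    (6 * (b' * c' + b' * d' + c' * d')) (- (4 * (b' + c' + d'))) (3 : F) r0.
rewrite /= !inE !negb_or => /and4P[/and3P[ab ac ad] /andP[bc bd] cd _] c1 c2 c3 c4 r0.
split; [apply: (first a b c d c1 c2 c3 c4) | apply: (first b a c d c2 c1 c3 c4)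
  | apply: (first c a b d c3 c1 c2 c4) | apply: (first d a b c c4 c1 c2 c3)];
  rewrite // 1?eq_sym // => n n5; rewrite -[RHS](r0 n n5) /dependence; ring.
Qed.

Lemma independent_ccci (a b c : F) : uniq [:: a; b; c] ->
  independent (pt a) (pt b) (pt c) None.
Proof.
rewrite /= !inE negb_or => /and3P[/andP[ab ac] bc _] c1 c2 c3 c4 r0.
have ba : b != a by rewrite eq_sym.
have ca : c != a by rewrite eq_sym.
have cb : c != b by rewrite eq_sym.
have c10 : c1 = 0.
  test ((a - b) * (a - c)) (b * c) (- (b + c)) (1 : F) (0 : F) (0 : F) r0.
have c20 : c2 = 0.
  test ((b - a) * (b - c)) (a * c) (- (a + c)) (1 : F) (0 : F) (0 : F) r0.
have c30 : c3 = 0.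
  test ((c - a) * (c - b)) (a * b) (- (a + b)) (1 : F) (0 : F) (0 : F) r0.
move: r0; rewrite c10 c20 c30 => r0; split=> //.
test (1 : F) (0 : F) (0 : F) (0 : F) (0 : F) (1 : F) r0.
Qed.

Lemma independent_ccti (a b c : F) : a != b ->
  independent (pt a) (pt b) (tg c) None.
Proof.
move=> ab c1 c2 c3 c4 r0; have ba : b != a by rewrite eq_sym.
have c30 : c3 = 0.
  have [gc0 | gc_neq0] := eqVneq ((c - a) * (c - b)) 0; last first.
    test ((c - a) * (c - b)) (- (c * a * b)) (a * b + c * a + c * b) (- (a + b + c)) (1 : F) (0 : F) r0.
  have gc'_neq0 : (c - a) + (c - b) != 0.
    by move/eqP: gc0; rewrite mulf_eq0 !subr_eq0 => /orP[] /eqP ->;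
      rewrite subrr ?add0r ?addr0 subr_eq0.
  test ((c - a) + (c - b)) (a * b) (- (a + b)) (1 : F) (0 : F) (0 : F) r0.
move: r0; rewrite c30 => r0.
have c10 : c1 = 0 by test (a - b) (- b) (1 : F) (0 : F) (0 : F) (0 : F) r0.
have c20 : c2 = 0 by test (b - a) (- a) (1 : F) (0 : F) (0 : F) (0 : F) r0.
move: r0; rewrite c10 c20 => r0; split=> //.
test (1 : F) (0 : F) (0 : F) (0 : F) (0 : F) (1 : F) r0.
Qed.

Lemma independent_ctti (a b c : F) : b != c ->
  independent (pt a) (tg b) (tg c) None.
Proof.
move=> bc c1 c2 c3 c4 r0; have cb : c != b by rewrite eq_sym.
have c10 : c1 = 0 by test (1 : F) (1 : F) (0 : F) (0 : F) (0 : F) (0 : F) r0.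
move: r0; rewrite c10 => r0.
have c20 : c2 = 0 by test (2 * (b - c)) (0 : F) (- (2 * c)) (1 : F) (0 : F) (0 : F) r0.
have c30 : c3 = 0 by test (2 * (c - b)) (0 : F) (- (2 * b)) (1 : F) (0 : F) (0 : F) r0.
move: r0; rewrite c20 c30 => r0; split=> //.
test (1 : F) (0 : F) (0 : F) (0 : F) (0 : F) (1 : F) r0.
Qed.

Lemma independent_ttti (a b c : F) : uniq [:: a; b; c] ->
  independent (tg a) (tg b) (tg c) None.
Proof.
rewrite /= !inE negb_or => /and3P[/andP[ab ac] bc _] c1 c2 c3 c4 r0.
have ba : b != a by rewrite eq_sym.
have ca : c != a by rewrite eq_sym.
have cb : c != b by rewrite eq_sym.
have c10 : c1 = 0.
  test (6 * ((a - b) * (a - c))) (0 : F) (6 * b * c) (- (3 * (b + c))) (2 : F) (0 : F) r0.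
have c20 : c2 = 0.
  test (6 * ((b - a) * (b - c))) (0 : F) (6 * a * c) (- (3 * (a + c))) (2 : F) (0 : F) r0.
have c30 : c3 = 0.
  test (6 * ((c - a) * (c - b))) (0 : F) (6 * a * b) (- (3 * (a + b))) (2 : F) (0 : F) r0.
move: r0; rewrite c10 c20 c30 => r0; split=> //.
test (1 : F) (0 : F) (0 : F) (0 : F) (0 : F) (1 : F) r0.
Qed.

End TrackIndependence.

(** * Back to points and planes of projective space *)

Section CompleteTrack.
Variable F : finFieldType.
Hypothesis nz2 : (2 : F) != 0.
Hypothesis nz3 : (3 : F) != 0.
Hypothesis nsq3 : forall y : F, y ^+ 2 != 3.

Local Notation index := (option (bool * F)).

Definition index_rank (i : index) : nat :=
  match i with Some (false, _) => 0 | Some (true, _) => 1 | None => 2 end.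

(** Independence does not depend on the order, so sorting by kind reduces to the nine patterns
    treated above; a repeated point at infinity is excluded by uniqueness. *)
Lemma track_independent (s : seq (index * F)) :
  size s = 4 -> uniq (unzip1 s) ->
  (forall n, (n < 5)%N -> \sum_(p <- s) p.2 * track_coord p.1 n = 0) ->
  all (fun p => p.2 == 0) s.
Proof.
pose le (p q : index * F) := (index_rank p.1 <= index_rank q.1)%N.
have le_total : total le by move=> p q; apply: leq_total.
rewrite -(perm_all _ (permEl (perm_sort le s))) -(size_sort le).
have /perm_map/perm_uniq <- := permEl (perm_sort le s).
move=> s4 us rs.
have {rs} : forall n, (n < 5)%N -> \sum_(p <- sort le s) p.2 * track_coord p.1 n = 0.
  by move=> n n5; rewrite -[RHS](rs n n5); apply: perm_big; rewrite perm_sort.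
have := sort_sorted le_total s; case: (sort le s) s4 us => [|[i c1]] //=.
move=> [|[j c2] [|[k c3] [|[l c4] []]]] //= _ uijkl srt rs.
have {}rs n : (n < 5)%N -> dependence i j k l c1 c2 c3 c4 n = 0.
  by move=> /rs; rewrite !big_cons big_nil addr0 /= !addrA.
suff [-> -> -> ->] : [/\ c1 = 0, c2 = 0, c3 = 0 & c4 = 0] by rewrite eqxx.
move: i j k l uijkl srt rs.
have ne (f : F -> index) u w : f u != f w -> u != w by apply: contraNneq => ->.
have uniq3 (f : F -> index) (x y z : F) (t : seq index) :
    uniq [:: f x, f y, f z & t] -> uniq [:: x; y; z].
  rewrite /= !inE !negb_or => /and3P[/and3P[xy xz _] /andP[yz _] _].
  by rewrite !andbT (ne _ _ _ xy) (ne _ _ _ xz) (ne _ _ _ yz).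
have neq2 (f : F -> index) (x y : F) (t : seq index) : uniq [:: f x, f y & t] -> x != y.
  by rewrite /= !inE !negb_or => /andP[/andP[/ne-> _] _].
have uniq4 (f : F -> index) (x y z t : F) :
    uniq [:: f x; f y; f z; f t] -> uniq [:: x; y; z; t].
  by apply: (@map_uniq _ _ f [:: x; y; z; t]).
have tl (x : index) t : uniq (x :: t) -> uniq t by case/andP.
pose pt t : index := Some (false, t); pose tg t : index := Some (true, t).
case=> [[[] a]|] [[[] b]|] [[[] c]|] [[[] d]|] ud; rewrite /le /= ?andbF // => _.
- exact: (independent_tttt nz2 nz3 (uniq4 tg _ _ _ _ ud)).
- exact: (independent_ttti nz2 nz3 (uniq3 tg _ _ _ _ ud)).
- by move: ud; rewrite /= !inE ?eqxx ?andbF.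
- exact: (independent_cttt nz2 nz3 (uniq3 tg _ _ _ _ (tl _ _ ud))).
- exact: (independent_ctti nz2 (neq2 tg _ _ _ (tl _ _ ud))).
- exact: (independent_cctt nz2 nsq3 (neq2 pt _ _ _ ud) (neq2 tg _ _ _ (tl _ _ (tl _ _ ud)))).
- exact: (independent_ccti (neq2 pt _ _ _ ud)).
- exact: (independent_ccct (uniq3 pt _ _ _ _ ud)).
- exact: (independent_cccc (uniq4 pt _ _ _ _ ud)).
- exact: (independent_ccci (uniq3 pt _ _ _ _ ud)).
- by move: ud; rewrite /= !inE ?eqxx ?andbF.
Qed.

(** Listing [s] first and then all other indices puts [s] among the first three. The fourth index is
    there because independence is stated for four points. *)
Lemma index_of_seq (s : seq index) : (3 < #|F|)%N -> (size s <= 3)%N ->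
  exists i j k l : index, uniq [:: i; j; k; l] /\ {subset s <= [:: i; j; k]}.
Proof.
move=> F4 s3; pose r := undup s ++ [seq x <- enum {: index} | x \notin s].
have ur : uniq r.
  rewrite cat_uniq undup_uniq filter_uniq ?enum_uniq // andbT.
  by apply/hasPn => x; rewrite mem_filter mem_undup => /andP[].
have sr : (4 <= size r)%N.
  apply: (@leq_trans #|{: index}|).
    by rewrite card_option card_prod card_bool ltnS (leq_trans (ltnW F4)) // leq_pmull.
  rewrite cardE; apply: uniq_leq_size; first exact: enum_uniq.
  move=> x xe; rewrite mem_cat mem_undup mem_filter xe andbT.
  by case: (x \in s).
have su : (size (undup s) <= 3)%N by apply: leq_trans (size_undup s) s3.
have sub : {subset s <= take 3 r}.
  by move=> x xs; rewrite take_cat ltnNge su /= mem_cat mem_undup xs.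
case: r ur sr sub => [|i [|j [|k [|l r]]]] //= ur _ sub.
exists i, j, k, l; split; last first.
  by move=> x /sub; case: (r).
have : uniq [:: i, j, k, l & r] by [].
by rewrite -[X in uniq X]/([:: i; j; k; l] ++ r) cat_uniq => /andP[].
Qed.

Definition track_vec (i : index) : 'rV[F]_5 := \row_n track_coord i n.

Lemma track_vecE a b : (track_vec (Some (false, a)) = coords 1 a (a ^+ 2) (a ^+ 3) (a ^+ 4))
  * (track_vec (Some (true, b)) = coords 0 1 (2 * b) (3 * b ^+ 2) (4 * b ^+ 3))
  * (track_vec None = coords 0 0 0 0 1).
Proof.
by do !split; apply/rowP; case=> [[|[|[|[|[|n]]]]]] // n5;
  rewrite !mxE /= ?mul0r ?expr1 ?mulr1.
Qed.

Lemma track_vec_free (i j k l : index) : uniq [:: i; j; k; l] ->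
  free [:: track_vec i; track_vec j; track_vec k; track_vec l].
Proof.
move=> uijkl.
pose X := [tuple track_vec i; track_vec j; track_vec k; track_vec l].
rewrite -[[:: _; _; _; _]]/(tval X); apply/freeP => c c0.
pose o n (n4 : (n < 4)%N) := Ordinal n4.
pose s := [:: (i, c (@o 0%N isT)); (j, c (@o 1%N isT)); (k, c (@o 2 isT)); (l, c (@o 3 isT))].
have : all (fun p => p.2 == 0) s.
  apply: track_independent => // n n5.
  have := congr1 (fun v : 'rV_5 => v 0 (Ordinal n5)) c0.
  rewrite /s !big_cons big_nil !big_ord_recl big_ord0 !mxE /= => c0n.
  rewrite -[RHS]c0n.
  by congr (_ * _ + (_ * _ + (_ * _ + (_ * _ + _)))); congr (c _); apply: val_inj.
case/and5P=> /eqP c1 /eqP c2 /eqP c3 /eqP c4 _.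
by case=> [[|[|[|[|n]]]] n4] //; [rewrite -c1 | rewrite -c2 | rewrite -c3 | rewrite -c4];
  congr (c _); apply: val_inj.
Qed.

Definition track_set : {set P4 F} :=
  curve_points F :|: tangent_points F :|: infinity_point F.

Lemma track_vec_neq0 i : track_vec i != 0.
Proof.
apply/eqP => /rowP v0; case: i v0 => [[[] t]|] v0.
- by have := v0 1; rewrite !mxE /= mulr1; apply/eqP/oner_neq0.
- by have := v0 0; rewrite !mxE /= expr0; apply/eqP/oner_neq0.
- by have := v0 (Ordinal (isT : (4 < 5)%N)); rewrite !mxE /=; apply/eqP/oner_neq0.
Qed.

Lemma track_point_subproof i : \dim <[track_vec i]> == 1%N.
Proof. by rewrite dim_vline track_vec_neq0. Qed.

Definition track_point (i : index) : P4 F := Sub <[track_vec i]>%VS (track_point_subproof i).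

Lemma track_setP (P : P4 F) : reflect (exists i, P = track_point i) (P \in track_set).
Proof.
rewrite 2!in_setU !in_set /has_coords; apply: (iffP idP) => [|[i ->]].
  case/orP => [/orP[]|].
  - move=> /existsP[t /eqP Pt]; exists (Some (false, t)).
    by apply: val_inj; rewrite Pt /= track_vecE.
  - move=> /existsP[t /eqP Pt]; exists (Some (true, t)).
    by apply: val_inj; rewrite Pt /= (track_vecE 0 t).
  - move=> /eqP Pt; exists None; apply: val_inj.
    by rewrite Pt /= (track_vecE 0 0).
case: i => [[[] t]|] /=.
- by apply/orP; left; apply/orP; right; apply/existsP; exists t; rewrite (track_vecE 0 t).
- by apply/orP; left; apply/orP; left; apply/existsP; exists t; rewrite (track_vecE t 0).
- by apply/orP; right; rewrite (track_vecE 0 0).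
Qed.

Lemma track_point_uniq (i j k l : index) : uniq [:: i; j; k; l] ->
  uniq [:: track_point i; track_point j; track_point k].
Proof.
move=> /track_vec_free; rewrite !free_cons => /and4P[ijk jk k_l _].
have neq (a b : index) (X : seq 'rV[F]_5) : track_vec a \notin <<X>>%VS ->
    track_vec b \in X -> track_point a != track_point b.
  move=> aX bX; apply: contraNneq aX => /(congr1 val) /= ab.
  by apply: (subvP (_ : <[track_vec a]> <= _)%VS); rewrite ?memv_line // ab -memvE memv_span.
have uniq3 (T : eqType) (x y z : T) : x != y -> x != z -> y != z -> uniq [:: x; y; z].
  by rewrite /= !inE => /negPf-> /negPf-> /negPf->.
by apply: uniq3; [apply: neq ijk _ | apply: neq ijk _ | apply: neq jk _];
  rewrite !in_cons eqxx ?orbT.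
Qed.

(** Four points of the track span dimension 4, more than the 3 of a plane. *)
Lemma track_set_track : track track_set.
Proof.
move=> _ _ _ _ /track_setP[i ->] /track_setP[j ->] /track_setP[k ->] /track_setP[l ->].
move=> us [W [/eqP W3 iW jW kW lW]].
have uijkl : uniq [:: i; j; k; l] by apply: (@map_uniq _ _ track_point).
have /eqP fX := track_vec_free uijkl.
have : (\dim <<[:: track_vec i; track_vec j; track_vec k; track_vec l]>> <= \dim W)%N.
  apply: dimvS; apply/span_subvP => v; rewrite !inE.
  by move=> /or4P[] /eqP ->; rewrite memvE.
by rewrite fX W3.
Qed.

(** A new point of a larger track would lie in the span of three points of the track. Once these are
    made distinct, their span is a plane containing four distinct points. *)
Lemma track_set_complete : (3 < #|F|)%N -> (forall x : nat -> F, covered x) ->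
  complete_track track_set.
Proof.
move=> F4 cov; split; first exact: track_set_track.
case=> T [trT /properP[/subsetP ST [P PT PS]]].
have /eqP dimP := valP P; pose x := vpick (val P).
have xP : (val P = <[x]>)%VS.
  apply/esym/eqP; rewrite -(dimv_leqif_eq _) ?dimP ?dim_vline ?vpick0.
    by rewrite -dimv_eq0 dimP.
  by rewrite -memvE memv_pick.
have [i [j [k [a [b [c xE]]]]]] := cov (fun n => x 0 (inord n)).
have {}xE : x = a *: track_vec i + b *: track_vec j + c *: track_vec k.
  by apply/rowP => n; rewrite !mxE -xE // inord_val.
have [i' [j' [k' [l [uniq4 sub]]]]] := index_of_seq F4 (isT : (size [:: i; j; k] <= 3)%N).
pose W := <<[:: track_vec i'; track_vec j'; track_vec k']>>%VS.
have fW : free [:: track_vec i'; track_vec j'; track_vec k'].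
  by apply: (@catl_free _ _ [:: track_vec l]); apply: track_vec_free.
have vW h : h \in [:: i; j; k] -> track_vec h \in W.
  by move=> /sub /(map_f track_vec); apply: memv_span.
have pT h : track_point h \in T by apply: ST; apply/track_setP; exists h.
have Pnot h : P != track_point h.
  by apply: contraNneq PS => ->; apply/track_setP; exists h.
have := track_point_uniq uniq4 => u3.
apply: (trT P (track_point i') (track_point j') (track_point k')) => //.
  have notin (D : eqType) (y : D) s : {in s, forall z, y != z} -> y \notin s.
    by move=> yz; apply: contraT; rewrite negbK => /yz; rewrite eqxx.
  rewrite cons_uniq u3 andbT -[X in _ \notin X]/[seq track_point h | h <- [:: i'; j'; k']].
  apply: notin.
  by move=> _ /mapP[h _ ->]; apply: Pnot.
exists W; split; rewrite /is_plane /lies_on /= -?memvE.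
- by rewrite (eqP fW).
- by rewrite xP -memvE xE !memvD ?memvZ // vW ?inE ?eqxx ?orbT.
- by apply: memv_span; rewrite !inE eqxx.
- by apply: memv_span; rewrite !inE eqxx orbT.
- by apply: memv_span; rewrite !inE eqxx !orbT.
Qed.

End CompleteTrack.

Unset Implicit Arguments.

Theorem theorem2p5 (F : finFieldType) (hq : (89 <= #|F|)%N)
  (h3 : ~ exists x : F, x ^+ 2 = 3) :
  complete_track (curve_points F :|: tangent_points F :|: infinity_point F).
Proof.
have nsq3 (y : F) : y ^+ 2 != 3 by apply/eqP => y3; apply: h3; exists y.
have nz3 : (3 : F) != 0 by rewrite eq_sym; have := nsq3 0; rewrite expr0n.
(* In characteristic 2, 3 = 1 would be a square. *)
have nz2 : (2 : F) != 0.
  apply: contraNneq (nsq3 1) => two0; apply/eqP.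
  by rewrite expr1n -[LHS]addr0 -two0; ring.
have [m q_odd] : exists m, #|F| = m.*2.+1.
  have [p p_pr pF] := finPcharP F.
  exists #|F|./2; rewrite -[LHS]odd_double_half; suff -> : odd #|F| by [].
  rewrite (card_pprimeChar pF) oddX; apply/orP; right.
  by case: (even_prime p_pr) pF => // -> /pcharf0/eqP; rewrite (negPf nz2).
apply: track_set_complete => //; first by apply: leq_trans hq.
exact: (covered_all q_odd hq nz2 nz3).
Qed.
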